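(* Let $a>b>0$ be arbitrary but fixed and let $x_1,x_2>0$ be such that $\mathcal{B}_{x_1,x_2}\left(\frac{a}{b}\right)>\frac{b}{a}$, where $$\mathcal{B}_{x_1,x_2}(q):=\frac{10(x_1+x_2)-15\left(\frac1{x_1}+\frac1{x_2}\right)}{2x_1^3\cdot q+2x_2^3},\qquad q>1.$$ Then a travelling wave solution of $$u_{tt}+u_{xxxx}+au^+-bu^-=1\ \ (x\in\mathbb{R},\,t>0),\qquad u(x,t)\to 1/a,\ u_x(x,t)\to 0\ \text{ for } |x|\to+\infty,$$ exists for any wave speed $c$ satisfying $$|c|\in\left(\sqrt[4]{\frac{4b}{\mathcal{B}_{x_1,x_2}(a/b)}},\ \sqrt[4]{4a}\right).$$
   Context: Here $u^{\pm}=\max\{\pm u,0\}$, so $u=u^+-u^-$. A travelling wave solution with wave speed $c$ is a (classical) solution of the problem $$u_{tt}+u_{xxxx}+au^+-bu^-=1\ \ (x\in\mathbb{R},\,t>0),\qquad u(x,t)\to 1/a,\ u_x(x,t)\to 0\ \text{ for } |x|\to+\infty,$$ of the form $u(x,t)=y(x-ct)$ which is nontrivial, i.e. $y\not\equiv 1/a$; equivalently, $z=y-1/a$ is a nontrivial solution of $z^{(4)}+c^2z''+a(z+1/a)^+-b(z+1/a)^--1=0$ on $\mathbb{R}$ with $z,z'\to0$ as $|s|\to+\infty$. *)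

(* Defs.v *)
From Stdlib Require Export Reals.
From Coquelicot Require Export Coquelicot.
Open Scope R_scope.

Definition pos_part (u : R) : R := Rmax u 0.
Definition neg_part (u : R) : R := Rmax (- u) 0.

Definition partial_x (k : nat) (u : R -> R -> R) (x t : R) : R :=
  Derive_n (fun x' => u x' t) k x.
Definition partial_t (k : nat) (u : R -> R -> R) (x t : R) : R :=
  Derive_n (fun t' => u x t') k t.

(* [Derive_n] is total, and [ex_derive_n f k x] only says that [Derive_n f (k-1)]
   is differentiable at x; hence existence is required at every order up to k. *)
Definition regular (u : R -> R -> R) : Prop :=
  forall x t, 0 < t ->
    (forall k, (k <= 4)%nat ->
       ex_derive_n (fun x' => u x' t) k x /\
       continuity_2d_pt (partial_x k u) x t) /\
    (forall k, (k <= 2)%nat ->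
       ex_derive_n (fun t' => u x t') k t /\
       continuity_2d_pt (partial_t k u) x t).

(* The values of u at t <= 0 play no role: {t > 0} is open, so they do not
   influence the derivatives at points with t > 0. *)
Definition classical_solution (a b : R) (u : R -> R -> R) : Prop :=
  regular u /\
  (forall x t, 0 < t ->
     partial_t 2 u x t + partial_x 4 u x t
       + a * pos_part (u x t) - b * neg_part (u x t) = 1) /\
  (forall t, 0 < t ->
     is_lim (fun x => u x t) p_infty (1 / a) /\
     is_lim (fun x => u x t) m_infty (1 / a) /\
     is_lim (fun x => partial_x 1 u x t) p_infty 0 /\
     is_lim (fun x => partial_x 1 u x t) m_infty 0).

Definition travelling_wave_solution (a b c : R) (u : R -> R -> R) : Prop :=
  classical_solution a b u /\
  exists y : R -> R,
    (forall x t, 0 < t -> u x t = y (x - c * t)) /\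
    (exists s, y s <> 1 / a).

Definition calB (x1 x2 q : R) : R :=
  (10 * (x1 + x2) - 15 * (1 / x1 + 1 / x2)) / (2 * x1 ^ 3 * q + 2 * x2 ^ 3).

(* Used at positive arguments only, where [Rpower] is the usual real power. *)
Definition root4 (x : R) : R := Rpower x (1 / 4).

(* Main.v *)
Require Import Defs.
From Stdlib Require Import Reals Lra Lia Psatz Classical ClassicalEpsilon.
From Coquelicot Require Import Coquelicot.
Open Scope R_scope.

(** Put [w = - z].  The profile equation reads [L w = (a - b) (w - 1/a)^+] with
    [L w = w'''' + c^2 w'' + a w], and since it is positively homogeneous in the
    pair (w, threshold), it is enough to solve [L w = (a - b) (w - mu)^+] with
    some threshold [mu > 0] and some decaying [w] that is positive somewhere
    ([wave_of_profile]).

    The bound [c^4 < 4 a] makes [L] positive definite: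
    [int w L w = int (w''^2 + c^2 w w'' + a w^2)] and the integrand is a positive
    definite quadratic form in [(w, w'')].  The problem is attacked through the dual
    variable [v = L w >= 0], by maximising over continuous [v >= 0] with compact
    support
    [F(v) = int v w - int v^2 / (a - b) - 2 mu0 t - (2/3) lam t^3],
    where [w = L^-1 v] and [t = int v].  The term [int v w] grows at most like [t^2],
    so the cubic penalty bounds [F] from above and no mountain pass argument is
    needed.  The functional is a convex quadratic form minus convex terms:
    linearising the convex form at [v] and maximising what remains gives
    [v' = (a - b) (w - mu)^+] with [mu = mu0 + lam t'^2], [t' = int v'], and
    [F(v') >= F(v) + int (v - v')^2 / (a - b)] ([ascent_step]).  Hence
    a [v] whose value is close to [sup F] almost satisfies the equation
    ([approx_solutions_exist]): [L w = (a - b) (w - mu)^+ + e] with [e] uniformly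
    small.  Because [mu >= mu0 > 0] the supports stay compact, and because
    [sup F > 0] the function [w] is bounded below by a fixed positive number at some
    point, which a translation moves to the origin.

    The approximate solutions are determined up to small errors by their Cauchy data
    at the origin and by [mu].  These lie in a bounded set, so along a suitable
    sequence they converge, and Gronwall's inequality turns this into local
    convergence to a true solution [W] ([limit_solution]).  The energy identity
    bounds [int w^2] uniformly; so [W] is a Lipschitz function in L^2, which
    tends to 0 at infinity together with its derivative.

    It remains to find one [v] with [int v w > int v^2 / (a - b)]; small enough [mu0]
    and [lam] then give [F(v) > 0].  Take [v = (a - b) phi^+] for a trial function
    [phi].  Integrating the nonnegative form of [w - phi] shows that it is enough that
    [int (phi''^2 + c^2 phi phi'' + a (phi^-)^2 + b (phi^+)^2) < 0].
    For [phi] a long train of parabolic humps, alternately positive of length [l2] and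
    negative of length [l1], each period contributes the same number, and with
    [l_i = x_i sqrt (8 / c^2)] this number is negative exactly when
    [c^4 > 4 b / calB x1 x2 (a / b)]; enough periods outweigh the two smooth ends of
    the train ([positive_rayleigh], [hump_costs_negative]). *)

(** * Continuity, derivatives and limits *)

Definition cont (f : R -> R) : Prop := forall x, continuous f x.

Lemma cont_const k : cont (fun _ => k).
Proof. intros x; apply continuous_const. Qed.
Lemma cont_id : cont (fun x => x).
Proof. intros x; apply continuous_id. Qed.
Lemma cont_plus f g : cont f -> cont g -> cont (fun x => f x + g x).
Proof. intros Hf Hg x; apply (continuous_plus f g x); auto. Qed.
Lemma cont_opp f : cont f -> cont (fun x => - f x).
Proof. intros Hf x; apply (continuous_opp f x); auto. Qed.
Lemma cont_minus f g : cont f -> cont g -> cont (fun x => f x - g x).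
Proof. intros Hf Hg x; apply (continuous_minus f g x); auto. Qed.
Lemma cont_mult f g : cont f -> cont g -> cont (fun x => f x * g x).
Proof. intros Hf Hg x; apply (continuous_mult f g x); auto. Qed.
Lemma cont_pow f n : cont f -> cont (fun x => f x ^ n).
Proof.
  intros Hf; induction n as [|n IH]; simpl.
  - apply cont_const.
  - apply cont_mult; auto.
Qed.
Lemma cont_comp f g : cont f -> cont g -> cont (fun x => f (g x)).
Proof. intros Hf Hg x; apply (continuous_comp g f x); auto. Qed.
Lemma cont_Rabs f : cont f -> cont (fun x => Rabs (f x)).
Proof.
  intros Hf; apply (cont_comp Rabs f); auto.
  intros x; apply continuous_Rabs.
Qed.
Lemma cont_pos f : cont f -> cont (fun x => Rmax (f x) 0).
Proof.
  intros Hf x.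
  apply (continuous_ext (fun x => / 2 * (f x + Rabs (f x)))).
  - intros y; unfold Rmax, Rabs; destruct (Rle_dec (f y) 0), (Rcase_abs (f y)); lra.
  - apply cont_mult; [apply cont_const|apply cont_plus; auto using cont_Rabs].
Qed.
Lemma cont_derive f g : (forall x, is_derive f x (g x)) -> cont f.
Proof. intros H x; apply (ex_derive_continuous (V := R_NormedModule)); exists (g x); apply H. Qed.
Lemma cont_exp : cont exp.
Proof. apply (cont_derive _ exp); intros x; apply is_derive_exp. Qed.
Lemma cont_cos : cont cos.
Proof. apply (cont_derive _ (fun x => - sin x)); intros x; apply is_derive_cos. Qed.
Lemma cont_sin : cont sin.
Proof. apply (cont_derive _ cos); intros x; apply is_derive_sin. Qed.

Ltac prove_cont :=
  match goal with
  | |- cont (fun x => x) => apply cont_id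
  | |- cont (fun _ => ?k) => apply cont_const
  | |- cont (fun x => @?f x + @?g x) => apply (cont_plus f g); cbv beta; prove_cont
  | |- cont (fun x => @?f x - @?g x) => apply (cont_minus f g); cbv beta; prove_cont
  | |- cont (fun x => @?f x * @?g x) => apply (cont_mult f g); cbv beta; prove_cont
  | |- cont (fun x => - @?f x) => apply (cont_opp f); cbv beta; prove_cont
  | |- cont (fun x => @?f x ^ _) => apply (cont_pow f); cbv beta; prove_cont
  | |- cont (fun x => Rmax (@?f x) 0) => apply (cont_pos f); cbv beta; prove_cont
  | |- cont (fun x => exp (@?g x)) => apply (cont_comp exp g); [apply cont_exp|cbv beta; prove_cont]
  | |- cont (fun x => cos (@?g x)) => apply (cont_comp cos g); [apply cont_cos|cbv beta; prove_cont]
  | |- cont (fun x => sin (@?g x)) => apply (cont_comp sin g); [apply cont_sin|cbv beta; prove_cont]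
  | _ => solve [assumption | eapply cont_derive; eassumption]
  | H : cont ?f |- cont (fun x => ?f (@?g x)) => apply (cont_comp f g); [exact H|cbv beta; prove_cont]
  end.

Lemma D_eq (f : R -> R) (x l l' : R) : is_derive f x l -> l = l' -> is_derive f x l'.
Proof. intros H <-; exact H. Qed.
Lemma D_plus (f g : R -> R) (x l m : R) :
  is_derive f x l -> is_derive g x m -> is_derive (fun y => f y + g y) x (l + m).
Proof. intros; apply (is_derive_plus f g); auto. Qed.
Lemma D_minus (f g : R -> R) (x l m : R) :
  is_derive f x l -> is_derive g x m -> is_derive (fun y => f y - g y) x (l - m).
Proof. intros; apply (is_derive_minus f g); auto. Qed.
Lemma D_opp (f : R -> R) (x l : R) :
  is_derive f x l -> is_derive (fun y => - f y) x (- l).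
Proof. intros; apply (is_derive_opp f); auto. Qed.
Lemma D_mult (f g : R -> R) (x l m : R) :
  is_derive f x l -> is_derive g x m ->
  is_derive (fun y => f y * g y) x (l * g x + f x * m).
Proof. intros; apply (is_derive_mult f g); auto. intros; apply Rmult_comm. Qed.
Lemma D_const (k x : R) : is_derive (fun _ : R => k) x 0.
Proof. apply (is_derive_const k x). Qed.
Lemma D_id (x : R) : is_derive (fun y : R => y) x 1.
Proof. apply (is_derive_id x). Qed.
Lemma D_comp (f g : R -> R) (x l m : R) :
  is_derive f (g x) l -> is_derive g x m -> is_derive (fun y => f (g y)) x (m * l).
Proof. intros; apply (is_derive_comp f g); auto. Qed.
Lemma D_pow (f : R -> R) (n : nat) (x l : R) :
  is_derive f x l -> is_derive (fun y => f y ^ n) x (INR n * l * f x ^ pred n).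
Proof. intros; apply is_derive_pow; auto. Qed.

Ltac derive_step :=
  match goal with
  | |- is_derive (fun x => x) _ _ => apply D_id
  | |- is_derive (fun _ => ?k) _ _ => apply D_const
  | |- is_derive (fun x => @?f x + @?g x) _ _ => apply (D_plus f g); cbv beta; derive_step
  | |- is_derive (fun x => @?f x - @?g x) _ _ => apply (D_minus f g); cbv beta; derive_step
  | |- is_derive (fun x => @?f x * @?g x) _ _ => apply (D_mult f g); cbv beta; derive_step
  | |- is_derive (fun x => - @?f x) _ _ => apply (D_opp f); cbv beta; derive_step
  | |- is_derive (fun x => @?f x ^ _) _ _ => apply (D_pow f); cbv beta; derive_step
  | |- is_derive (fun x => exp (@?g x)) _ _ => apply (D_comp exp g); [apply is_derive_exp|cbv beta; derive_step]
  | |- is_derive (fun x => cos (@?g x)) _ _ => apply (D_comp cos g); [apply is_derive_cos|cbv beta; derive_step]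
  | |- is_derive (fun x => sin (@?g x)) _ _ => apply (D_comp sin g); [apply is_derive_sin|cbv beta; derive_step]
  | H : forall x, is_derive ?f x _ |- is_derive ?f _ _ => apply H
  | H : forall x, is_derive ?f x _ |- is_derive (fun x => ?f x) _ _ => apply H
  | H : forall x, is_derive ?f x _ |- is_derive (fun x => ?f (@?g x)) _ _ =>
      apply (D_comp f g); [apply H|cbv beta; derive_step]
  | _ => eassumption
  end.
(* [prove_derive] leaves the equation between the computed and the claimed derivative. *)
Ltac prove_derive := eapply D_eq; [derive_step|simpl].

Lemma nondecreasing_of_derive (f g : R -> R) p q :
  (forall x, p <= x <= q -> is_derive f x (g x)) ->
  (forall x, p <= x <= q -> 0 <= g x) -> p <= q -> f p <= f q.
Proof.
  intros Hd Hp Hpq.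
  destruct (MVT_gen f p q g) as [z [Hz E]].
  - intros x Hx; apply Hd; rewrite Rmin_left, Rmax_right in Hx by lra; lra.
  - intros x Hx; rewrite Rmin_left, Rmax_right in Hx by lra.
    apply continuity_pt_filterlim.
    apply (ex_derive_continuous (V := R_NormedModule)); exists (g x); apply Hd; lra.
  - rewrite Rmin_left, Rmax_right in Hz by lra.
    specialize (Hp z Hz). nra.
Qed.

Lemma mean_value (f g : R -> R) p q :
  (forall x, is_derive f x (g x)) ->
  exists z, Rmin p q <= z <= Rmax p q /\ f q - f p = g z * (q - p).
Proof.
  intros Hd. destruct (MVT_gen f p q g) as [z [Hz E]].
  - auto.
  - intros x _; apply continuity_pt_filterlim. apply (cont_derive _ _ Hd).
  - exists z; auto.
Qed.

Lemma lipschitz_of_derive (f g : R -> R) C :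
  (forall x, is_derive f x (g x)) -> (forall x, Rabs (g x) <= C) ->
  forall x y, Rabs (f y - f x) <= C * Rabs (y - x).
Proof.
  intros Hd Hb x y. destruct (mean_value f g x y Hd) as [z [_ ->]].
  rewrite Rabs_mult. apply Rmult_le_compat_r; auto using Rabs_pos.
Qed.

Lemma lim_p_eps (f : R -> R) (l : R) :
  (forall eps, 0 < eps -> exists M, forall x, M < x -> Rabs (f x - l) <= eps) ->
  is_lim f p_infty l.
Proof.
  intros H. apply is_lim_spec. intros eps.
  destruct (H (eps / 2)) as [M HM]; [destruct eps; simpl; lra|].
  exists M; intros x Hx. specialize (HM x Hx). destruct eps as [e He]; simpl in *; lra.
Qed.

Lemma lim_reflect (f : R -> R) (l : R) :
  is_lim f p_infty l -> is_lim (fun x => f (- x)) m_infty l.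
Proof.
  intros H. apply is_lim_spec. apply is_lim_spec in H. intros eps.
  destruct (H eps) as [M HM]. exists (- M); intros x Hx; apply HM; lra.
Qed.

Lemma lim_reflect_m (f : R -> R) (l : R) :
  is_lim f m_infty l -> is_lim (fun x => f (- x)) p_infty l.
Proof.
  intros H. apply is_lim_spec. apply is_lim_spec in H. intros eps.
  destruct (H eps) as [M HM]. exists (- M); intros x Hx; apply HM; lra.
Qed.

(** From [exp y >= 1 + y] it follows that [exp (- al x) <= 1 / (al x)] for positive [x]. *)
Lemma exp_decay_lim (f : R -> R) al K : 0 < al ->
  (forall x, Rabs (f x) <= K * exp (- (al * x))) -> is_lim f p_infty 0.
Proof.
  intros Hal H. apply lim_p_eps; intros eps He.
  assert (HK : 0 <= K).
  { specialize (H 0). pose proof (Rabs_pos (f 0)). pose proof (exp_pos (- (al * 0))). nra. }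
  exists (K / (al * eps)); intros x Hx. rewrite Rminus_0_r.
  eapply Rle_trans; [apply H|].
  assert (K / (al * eps) * (al * eps) = K) by (field; lra).
  assert (0 <= K / (al * eps)) by (apply Rdiv_le_0_compat; nra).
  assert (0 < al * eps) by nra.
  assert (K <= x * (al * eps)) by nra.
  rewrite exp_Ropp. pose proof (exp_ineq1 (al * x)) as E.
  assert (0 < al * x) by nra.
  apply Rmult_le_reg_r with (exp (al * x)); [apply exp_pos|].
  rewrite Rmult_assoc, Rinv_l by (apply Rgt_not_eq, exp_pos).
  assert (1 + al * x < exp (al * x)) by (apply E; lra). nra.
Qed.

Lemma lim_of_reflection (f : R -> R) (l : R) :
  is_lim (fun x => f (- x)) p_infty l -> is_lim f m_infty l.
Proof.
  intros H. apply lim_reflect in H. eapply is_lim_ext; [|exact H].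
  intros x; simpl; f_equal; ring.
Qed.

Lemma lim_shift (f : R -> R) (l d : R) :
  (is_lim f p_infty l -> is_lim (fun x => f (x - d)) p_infty l) /\
  (is_lim f m_infty l -> is_lim (fun x => f (x - d)) m_infty l).
Proof.
  split; intros H; apply is_lim_spec; apply is_lim_spec in H; intros eps;
    destruct (H eps) as [M HM]; exists (M + d); intros x Hx; apply HM; lra.
Qed.

Lemma cont_lipschitz f L : 0 <= L ->
  (forall x y, Rabs (f y - f x) <= L * Rabs (y - x)) -> cont f.
Proof.
  intros HL H x. apply filterlim_locally. intros [e He].
  assert (Hd : 0 < e / (L + 1)) by (apply Rdiv_lt_0_compat; lra).
  exists (mkposreal _ Hd); intros y Hy.
  change (Rabs (f y - f x) < e). change (Rabs (y - x) < e / (L + 1)) in Hy.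
  eapply Rle_lt_trans; [apply H|].
  apply Rle_lt_trans with (L * (e / (L + 1))); [apply Rmult_le_compat_l; lra|].
  apply Rmult_lt_reg_r with (L + 1); [lra|].
  replace (L * (e / (L + 1)) * (L + 1)) with (L * e) by (field; lra). nra.
Qed.

Lemma lim_mult0 (f g : R -> R) (z : Rbar) :
  is_lim f z 0 -> is_lim g z 0 -> is_lim (fun x => f x * g x) z 0.
Proof.
  intros Hf Hg. replace (Finite 0) with (Finite (0 * 0)) by (f_equal; ring).
  apply (is_lim_mult f g z 0 0); simpl; auto.
Qed.

Lemma lim_plus0 (f g : R -> R) (z : Rbar) :
  is_lim f z 0 -> is_lim g z 0 -> is_lim (fun x => f x + g x) z 0.
Proof.
  intros Hf Hg. replace (Finite 0) with (Finite (0 + 0)) by (f_equal; ring).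
  apply (is_lim_plus' f g z 0 0); auto.
Qed.

Lemma lim_scal0 (f : R -> R) k (z : Rbar) :
  is_lim f z 0 -> is_lim (fun x => k * f x) z 0.
Proof.
  intros Hf. replace (Finite 0) with (Rbar_mult k 0) by (simpl; f_equal; ring).
  apply is_lim_scal_l; auto.
Qed.

Lemma lim_minus0 (f g : R -> R) (z : Rbar) :
  is_lim f z 0 -> is_lim g z 0 -> is_lim (fun x => f x - g x) z 0.
Proof.
  intros Hf Hg. replace (Finite 0) with (Finite (0 - 0)) by (f_equal; ring).
  apply (is_lim_minus' f g z 0 0); auto.
Qed.

Lemma Rmax_pos_lip u v : Rabs (Rmax u 0 - Rmax v 0) <= Rabs (u - v).
Proof.
  unfold Rmax; destruct (Rle_dec u 0), (Rle_dec v 0); unfold Rabs;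
    repeat destruct Rcase_abs; lra.
Qed.

(** * Integrals over the line *)

Lemma cont_ex_RInt f p q : cont f -> ex_RInt f p q.
Proof. intros Hf; apply (ex_RInt_continuous (V := R_CompleteNormedModule)); auto. Qed.

Lemma derive_RInt_cont f p : cont f -> forall x, is_derive (fun y => RInt f p y) x (f x).
Proof.
  intros Hf x. apply is_derive_RInt with p.
  - exists (mkposreal 1 Rlt_0_1); intros y _.
    apply (RInt_correct (V := R_CompleteNormedModule)), cont_ex_RInt; auto.
  - apply Hf.
Qed.

Lemma RInt_FTC (F f : R -> R) p q :
  cont f -> (forall x, is_derive F x (f x)) -> RInt f p q = F q - F p.
Proof.
  intros Hf HF. apply is_RInt_unique. apply (is_RInt_derive F f); auto.
Qed.

Lemma RInt_mono f g p q : cont f -> cont g -> p <= q ->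
  (forall x, p <= x <= q -> f x <= g x) -> RInt f p q <= RInt g p q.
Proof.
  intros Hf Hg Hpq H. apply RInt_le; auto using cont_ex_RInt.
  intros x Hx; apply H; lra.
Qed.

Lemma RInt_cst (k p q : R) : RInt (fun _ => k) p q = (q - p) * k.
Proof. rewrite RInt_const; reflexivity. Qed.

Lemma RInt_nonneg f p q : cont f -> p <= q ->
  (forall x, p <= x <= q -> 0 <= f x) -> 0 <= RInt f p q.
Proof.
  intros Hf Hpq H.
  rewrite <- (Rmult_0_r (q - p)), <- RInt_cst.
  apply RInt_mono; auto using cont_const.
Qed.

Lemma RInt_split f p q r : cont f -> RInt f p r = RInt f p q + RInt f q r.
Proof.
  intros Hf; symmetry; apply (RInt_Chasles (V := R_CompleteNormedModule)); auto using cont_ex_RInt.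
Qed.

Lemma RInt_zero_on f p q :
  (forall x, Rmin p q < x < Rmax p q -> f x = 0) -> RInt f p q = 0.
Proof.
  intros H. rewrite (RInt_ext f (fun _ => 0)) by auto.
  rewrite RInt_cst; apply Rmult_0_r.
Qed.

Lemma RInt_lin f g k l p q : cont f -> cont g ->
  RInt (fun x => k * f x + l * g x) p q = k * RInt f p q + l * RInt g p q.
Proof.
  intros Hf Hg.
  apply is_RInt_unique.
  apply (is_RInt_plus (V := R_NormedModule) (fun x => k * f x) (fun x => l * g x)).
  - apply (is_RInt_scal (V := R_NormedModule) f). apply (RInt_correct (V := R_CompleteNormedModule)); auto using cont_ex_RInt.
  - apply (is_RInt_scal (V := R_NormedModule) g). apply (RInt_correct (V := R_CompleteNormedModule)); auto using cont_ex_RInt.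
Qed.

(** A symmetric improper integral; carrying the continuity of the integrand along keeps the
    Riemann integrability side conditions out of later proofs. *)
Definition total (f : R -> R) (I : R) : Prop :=
  cont f /\ is_lim (fun r => RInt f (- r) r) p_infty I.

Lemma total_compact f r : cont f -> 0 <= r ->
  (forall x, r <= Rabs x -> f x = 0) -> total f (RInt f (- r) r).
Proof.
  intros Hf Hr H; split; auto.
  apply is_lim_ext_loc with (fun _ => RInt f (- r) r).
  - exists r; intros s Hs.
    rewrite (RInt_split f (- s) (- r) s), (RInt_split f (- r) r s) by auto.
    rewrite (RInt_zero_on f (- s) (- r)), (RInt_zero_on f r s);
      [rewrite Rplus_0_r, Rplus_0_l; reflexivity| |].
    + intros x Hx; rewrite Rmin_left, Rmax_right in Hx by lra.
      apply H; rewrite Rabs_pos_eq; lra.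
    + intros x Hx; rewrite Rmin_left, Rmax_right in Hx by lra.
      apply H; rewrite Rabs_left; lra.
  - apply is_lim_const.
Qed.

Lemma total_lin f g I J k l : total f I -> total g J ->
  total (fun x => k * f x + l * g x) (k * I + l * J).
Proof.
  intros [Hf If] [Hg Ig]; split; [prove_cont|].
  apply is_lim_ext with (fun r => k * RInt f (- r) r + l * RInt g (- r) r).
  - intros r; symmetry; apply RInt_lin; auto.
  - apply (is_lim_plus' _ _ _ (k * I) (l * J)).
    + apply (is_lim_scal_l _ k p_infty (Finite I)); auto.
    + apply (is_lim_scal_l _ l p_infty (Finite J)); auto.
Qed.

Lemma total_le f g I J : total f I -> total g J -> (forall x, f x <= g x) -> I <= J.
Proof.
  intros [Hf If] [Hg Ig] H.
  apply (is_lim_le_loc (fun r => RInt f (- r) r) (fun r => RInt g (- r) r) p_infty I J); auto.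
  exists 0; intros r Hr. apply RInt_mono; auto; lra.
Qed.

Lemma total_eq f g I J : total f I -> total g J -> (forall x, f x = g x) -> I = J.
Proof.
  intros Hf Hg H; apply Rle_antisym; eapply total_le; eauto; intros x; rewrite H; lra.
Qed.

Lemma total_nonneg f I : total f I -> (forall x, 0 <= f x) -> 0 <= I.
Proof.
  intros Hf H. replace 0 with (0 * I + 0 * I) by ring.
  apply (total_le _ _ _ _ (total_lin _ _ _ _ 0 0 Hf Hf) Hf).
  intros x; specialize (H x); lra.
Qed.

Lemma total_ext f g I J : total f I -> (forall x, f x = g x) -> I = J -> total g J.
Proof.
  intros [Hf If] E <-; split.
  - intros x; apply (continuous_ext f); auto.
  - eapply is_lim_ext; [|exact If]. intros r. apply RInt_ext; auto.
Qed.

(** This is how integrations by parts are done below: a total derivative of something that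
    vanishes at infinity does not contribute. *)
Lemma total_derive (F f : R -> R) : cont f -> (forall x, is_derive F x (f x)) ->
  is_lim F p_infty 0 -> is_lim F m_infty 0 -> total f 0.
Proof.
  intros Hf HF Hp Hm; split; auto.
  apply is_lim_ext with (fun r => F r - F (- r)).
  - intros r; symmetry; apply RInt_FTC; auto.
  - replace (Finite 0) with (Finite (0 - 0)) by (f_equal; ring).
    apply (is_lim_minus' _ _ _ 0 0); auto.
    apply (is_lim_comp F (fun r => - r) p_infty 0 m_infty); auto.
    + apply (is_lim_opp (fun r => r) p_infty p_infty), is_lim_id.
    + exists 0; intros; discriminate.
Qed.

Lemma total_part f I p q : total f I -> (forall x, x <= p \/ q <= x -> 0 <= f x) -> p <= q ->
  RInt f p q <= I.
Proof.
  intros [Hf If] H Hpq.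
  apply (is_lim_le_loc (fun _ => RInt f p q) (fun r => RInt f (- r) r) p_infty (RInt f p q) I);
    [|apply is_lim_const|auto].
  - exists (Rabs p + Rabs q); intros r Hr.
    pose proof (Rle_abs p); pose proof (Rle_abs (- p)); pose proof (Rle_abs q).
    pose proof (Rabs_pos p); pose proof (Rabs_pos q).
    rewrite Rabs_Ropp in *.
    rewrite (RInt_split f (- r) p r), (RInt_split f p q r) by auto.
    assert (0 <= RInt f (- r) p).
    { apply RInt_nonneg; auto; [lra|]. intros x Hx; apply H; lra. }
    assert (0 <= RInt f q r).
    { apply RInt_nonneg; auto; [lra|]. intros x Hx; apply H; lra. }
    lra.
Qed.

(** Being at least [d] at [x], the function stays above [d / 2] on an interval of length
    [d / (2 K)].  So small square integrals force small values, both for error terms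
    and for tails at infinity. *)
Lemma lipschitz_square_mass g K x d : cont g -> 0 < K -> 0 < d ->
  (forall y z, Rabs (g z - g y) <= K * Rabs (z - y)) -> d <= Rabs (g x) ->
  d ^ 3 / (8 * K) <= RInt (fun y => g y ^ 2) x (x + d / (2 * K)).
Proof.
  intros Hg HK Hd HL Hx.
  assert (Hh : 0 < d / (2 * K)) by (apply Rdiv_lt_0_compat; lra).
  assert (E : d ^ 3 / (8 * K) = RInt (fun _ => (d / 2) ^ 2) x (x + d / (2 * K))).
  { rewrite RInt_cst; field; lra. }
  rewrite E. apply RInt_mono; [prove_cont|prove_cont|lra|].
  intros y Hy.
  assert (Rabs (g y - g x) <= d / 2).
  { eapply Rle_trans; [apply HL|]. rewrite Rabs_pos_eq by lra.
    apply Rle_trans with (K * (d / (2 * K))).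
    - apply Rmult_le_compat_l; lra.
    - right; field; lra. }
  assert (d / 2 <= Rabs (g y)).
  { pose proof (Rabs_triang (g y) (- (g y - g x))) as T.
    replace (g y + - (g y - g x)) with (g x) in T by ring. rewrite Rabs_Ropp in T. lra. }
  rewrite <- (pow2_abs (g y)). apply pow_incr; lra.
Qed.

Lemma RInt_translate f x0 x y : cont f -> RInt (fun s => f (s + x0)) x y = RInt f (x + x0) (y + x0).
Proof.
  intros Cf. pose proof (derive_RInt_cont f (x + x0) Cf) as D.
  rewrite (RInt_FTC (fun s => RInt f (x + x0) (s + x0)) (fun s => f (s + x0))); [|prove_cont|].
  - assert (Z : 0 = RInt f (x + x0) (x + x0)).
    { symmetry; apply RInt_zero_on. intros s Hs. rewrite Rmin_left, Rmax_left in Hs; lra. }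
    rewrite <- Z, Rminus_0_r. reflexivity.
  - intros s. eapply D_eq; [apply (D_comp (fun y => RInt f (x + x0) y)); [apply D|apply D_plus; [apply D_id|apply D_const]]|].
    simpl; ring.
Qed.

Lemma D_translate (f : R -> R) x0 x l : is_derive f (x + x0) l -> is_derive (fun s => f (s + x0)) x l.
Proof.
  intros D. eapply D_eq; [apply (D_comp f); [apply D|apply D_plus; [apply D_id|apply D_const]]|]. ring.
Qed.

Definition bump (v : R -> R) : Prop :=
  cont v /\ (forall x, 0 <= v x) /\
  exists r, 0 <= r /\ forall x, r <= Rabs x -> v x = 0.

Lemma bump_total v : bump v -> exists t, total v t.
Proof. intros (Hc & _ & r & Hr & Hz). eexists; apply (total_compact v r); auto. Qed.

Lemma bump_total_mult v f : bump v -> cont f -> exists p, total (fun x => v x * f x) p.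
Proof.
  intros (Hc & _ & r & Hr & Hz) Hf. eexists; apply (total_compact _ r); auto; [prove_cont|].
  intros x Hx; rewrite Hz by auto; ring.
Qed.

Lemma bump_total_nonneg v t : bump v -> total v t -> 0 <= t.
Proof.
  intros (Hc & Hp & _) Ht.
  apply (total_nonneg v t Ht Hp).
Qed.

(** * The resolvent of the linear operator *)

(** The weight only matters where [v] is nonzero and to the left of [x]; both bounds that are
    needed for the kernel below, one growing with [x] and one uniform, come from this. *)
Lemma weighted_bound g v t r x B : cont g -> bump v -> total v t -> 0 <= r ->
  (forall y, r <= Rabs y -> v y = 0) -> 0 <= B ->
  (forall y, y <= x -> v y = 0 \/ Rabs (g y) <= B) ->
  Rabs (RInt (fun y => g y * v y) (- r) x) <= B * t.
Proof.
  intros Hg Hv Ht Hr Hz HB H.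
  pose proof (bump_total_nonneg v t Hv Ht) as Ht0.
  destruct Hv as (Hc & Hp & _).
  assert (Hgv : cont (fun y => g y * v y)) by prove_cont.
  destruct (Rle_dec x (- r)) as [Hx|Hx].
  - rewrite RInt_zero_on.
    + rewrite Rabs_R0; nra.
    + intros y Hy; rewrite Rmin_right, Rmax_left in Hy by lra.
      rewrite Hz; [ring|]. rewrite Rabs_left; lra.
  - assert (P : RInt (fun y => B * v y + 0 * v y) (- r) x = B * RInt v (- r) x + 0 * RInt v (- r) x)
      by (apply RInt_lin; auto).
    assert (Q : RInt v (- r) x <= t) by (apply total_part; auto; lra).
    assert (cont (fun y => B * v y + 0 * v y)) by prove_cont.
    assert (bd : forall y, y <= x -> - (B * v y) <= g y * v y <= B * v y).
    { intros y Hy. specialize (Hp y). destruct (H y Hy) as [->|E]; [nra|].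
      pose proof (Rle_abs (g y)); pose proof (Rle_abs (- g y)). rewrite Rabs_Ropp in *. nra. }
    assert (U : RInt (fun y => g y * v y) (- r) x <= RInt (fun y => B * v y + 0 * v y) (- r) x).
    { apply RInt_mono; auto; try lra. intros y Hy; specialize (bd y); lra. }
    assert (L : RInt (fun y => -1 * (B * v y + 0 * v y) + 0 * v y) (- r) x
                <= RInt (fun y => g y * v y) (- r) x).
    { apply RInt_mono; auto; try lra; [prove_cont|]. intros y Hy; specialize (bd y); lra. }
    rewrite RInt_lin in L by auto.
    apply Rabs_le. nra.
Qed.

(** Variation of constants: [p] and [q] are the convolutions of [v] with the causal kernels
    [exp (- al x) cos (be x)] and [exp (- al x) sin (be x)], [x >= 0].  The addition formulas
    separate the variables, which leaves the integrals [U] and [V]; the growing weight under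
    the integral sign is compensated by the decaying factor in front. *)
Lemma forward_kernel al be v t : 0 < al -> bump v -> total v t ->
  exists p q,
    (forall x, is_derive p x (- al * p x - be * q x + v x)) /\
    (forall x, is_derive q x (- al * q x + be * p x)) /\
    (forall x, Rabs (p x) <= 2 * t /\ Rabs (q x) <= 2 * t) /\
    (is_lim p p_infty 0 /\ is_lim q p_infty 0) /\
    (is_lim p m_infty 0 /\ is_lim q m_infty 0).
Proof.
  intros Hal Hv Ht.
  pose proof (bump_total_nonneg v t Hv Ht) as Ht0.
  pose proof Hv as (Hc & Hp & r & Hr & Hz).
  set (gc := fun y => exp (al * y) * cos (be * y)).
  set (gs := fun y => exp (al * y) * sin (be * y)).
  assert (Cgc : cont gc) by (unfold gc; prove_cont).
  assert (Cgs : cont gs) by (unfold gs; prove_cont).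
  set (U := fun x => RInt (fun y => gc y * v y) (- r) x).
  set (V := fun x => RInt (fun y => gs y * v y) (- r) x).
  assert (DU : forall x, is_derive U x (gc x * v x)) by (intros x; apply (derive_RInt_cont (fun y => gc y * v y)); prove_cont).
  assert (DV : forall x, is_derive V x (gs x * v x)) by (intros x; apply (derive_RInt_cont (fun y => gs y * v y)); prove_cont).
  assert (bc : forall y, Rabs (gc y) <= exp (al * y)).
  { intros y; unfold gc. rewrite Rabs_mult, (Rabs_pos_eq (exp _)) by (left; apply exp_pos).
    rewrite <- (Rmult_1_r (exp (al * y))) at 2.
    apply Rmult_le_compat_l; [left; apply exp_pos|]. apply Rabs_le, COS_bound. }
  assert (bs : forall y, Rabs (gs y) <= exp (al * y)).
  { intros y; unfold gs. rewrite Rabs_mult, (Rabs_pos_eq (exp _)) by (left; apply exp_pos).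
    rewrite <- (Rmult_1_r (exp (al * y))) at 2.
    apply Rmult_le_compat_l; [left; apply exp_pos|]. apply Rabs_le, SIN_bound. }
  assert (mono : forall y z, y <= z -> exp (al * y) <= exp (al * z)).
  { intros y z [Hyz| ->]; [left; apply exp_increasing; nra|lra]. }
  assert (loc : forall x g, cont g -> (forall y, Rabs (g y) <= exp (al * y)) ->
     Rabs (RInt (fun y => g y * v y) (- r) x) <= exp (al * x) * t).
  { intros x g Cg bg. apply weighted_bound; auto.
    - left; apply exp_pos.
    - intros y Hy; right. eapply Rle_trans; [apply bg|auto]. }
  assert (glob : forall x g, cont g -> (forall y, Rabs (g y) <= exp (al * y)) ->
     Rabs (RInt (fun y => g y * v y) (- r) x) <= exp (al * r) * t).
  { intros x g Cg bg. apply weighted_bound; auto.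
    - left; apply exp_pos.
    - intros y Hy. destruct (Rle_dec y r) as [Hyr|Hyr].
      + right. eapply Rle_trans; [apply bg|auto].
      + left; apply Hz. rewrite Rabs_pos_eq; lra. }
  assert (comb : forall x B cs sn, -1 <= cs <= 1 -> -1 <= sn <= 1 ->
     Rabs (U x) <= B -> Rabs (V x) <= B ->
     Rabs (exp (- (al * x)) * (cs * U x + sn * V x)) <= exp (- (al * x)) * (2 * B)).
  { intros x B cs sn Hcs Hsn HU HV.
    rewrite Rabs_mult, (Rabs_pos_eq (exp _)) by (left; apply exp_pos).
    apply Rmult_le_compat_l; [left; apply exp_pos|].
    eapply Rle_trans; [apply Rabs_triang|]. rewrite !Rabs_mult.
    pose proof (Rabs_pos (U x)); pose proof (Rabs_pos (V x)).
    apply Rabs_le in Hcs. apply Rabs_le in Hsn.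
    pose proof (Rabs_pos cs); pose proof (Rabs_pos sn). nra. }
  set (p := fun x => exp (- (al * x)) * (cos (be * x) * U x + sin (be * x) * V x)).
  set (q := fun x => exp (- (al * x)) * (sin (be * x) * U x + (- cos (be * x)) * V x)).
  assert (CB : forall x, -1 <= cos (be * x) <= 1) by (intros; apply COS_bound).
  assert (SB : forall x, -1 <= sin (be * x) <= 1) by (intros; apply SIN_bound).
  assert (NB : forall x, -1 <= - cos (be * x) <= 1) by (intros x; specialize (CB x); lra).
  assert (cancel : forall x, exp (- (al * x)) * exp (al * x) = 1).
  { intros x; rewrite <- exp_plus, Rplus_opp_l, exp_0; reflexivity. }
  assert (E1 : forall x, exp (- (al * x)) * (2 * (exp (al * x) * t)) = 2 * t).
  { intros x; replace (exp (- (al * x)) * (2 * (exp (al * x) * t)))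
      with ((exp (- (al * x)) * exp (al * x)) * (2 * t)) by ring. rewrite cancel; ring. }
  exists p, q; split; [|split; [|split; [|split]]].
  - intros x. unfold p at 1. prove_derive. unfold p, q, gc, gs.
    transitivity (- al * (exp (- (al * x)) * (cos (be * x) * U x + sin (be * x) * V x)) -
      be * (exp (- (al * x)) * (sin (be * x) * U x + - cos (be * x) * V x)) +
      (exp (- (al * x)) * exp (al * x)) * (sin (be * x) ^ 2 + cos (be * x) ^ 2) * v x).
    + ring.
    + rewrite cancel. replace (sin (be * x) ^ 2 + cos (be * x) ^ 2) with 1; [ring|].
      pose proof (sin2_cos2 (be * x)) as S. unfold Rsqr in S. lra.
  - intros x. unfold q at 1. prove_derive. unfold p, q, gc, gs. ring.
  - intros x; split; rewrite <- (E1 x); apply comb; auto; apply loc; auto.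
  - split; apply (exp_decay_lim _ al (2 * (exp (al * r) * t))); auto; intros x;
      rewrite (Rmult_comm (2 * _)); apply comb; auto; apply glob; auto.
  - assert (Z : forall x, x <= - r -> U x = 0 /\ V x = 0).
    { intros x Hx; split; apply RInt_zero_on; intros y Hy;
        rewrite Rmin_right, Rmax_left in Hy by lra;
        (rewrite Hz; [ring|]; rewrite Rabs_left; lra). }
    split; apply (is_lim_ext_loc (fun _ => 0)); try apply is_lim_const;
      exists (- r); intros x Hx; destruct (Z x) as [ZU ZV]; try lra;
      unfold p, q; rewrite ZU, ZV; ring.
Qed.

(** [w 0] is the decaying solution of [w'''' + c2 w'' + a w = v], and [w 1], [w 2], [w 3]
    are its derivatives. *)
Record resolvent (c2 a : R) (v : R -> R) (w : nat -> R -> R) : Prop := {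
  res_derive : forall k x, (k < 3)%nat -> is_derive (w k) x (w (S k) x);
  res_derive3 : forall x, is_derive (w 3%nat) x (v x - c2 * w 2%nat x - a * w 0%nat x);
  res_lim_p : forall k, (k <= 3)%nat -> is_lim (w k) p_infty 0;
  res_lim_m : forall k, (k <= 3)%nat -> is_lim (w k) m_infty 0
}.

Lemma reflect_bump v t : bump v -> total v t -> bump (fun x => v (- x)) /\ total (fun x => v (- x)) t.
Proof.
  intros (Hc & Hp & r & Hr & Hz) [_ Ht].
  assert (C : cont (fun x => v (- x))) by prove_cont.
  split.
  - split; [exact C|split; [auto|]]. exists r; split; auto.
    intros x Hx; apply Hz; rewrite Rabs_Ropp; auto.
  - split; auto. eapply is_lim_ext; [|exact Ht]. intros R; simpl.
    rewrite (RInt_FTC (fun x => - RInt v 0 (- x)) (fun x => v (- x))); auto.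
    + rewrite Ropp_involutive. rewrite (RInt_split v (- R) 0 R) by auto.
      rewrite <- (opp_RInt_swap v (- R) 0) by (apply cont_ex_RInt; auto).
      unfold opp; simpl. ring.
    + intros x. pose proof (derive_RInt_cont v 0 Hc) as D.
      eapply D_eq; [apply D_opp; apply (D_comp (fun y => RInt v 0 y)); [apply D|apply D_opp, D_id]|].
      simpl; ring.
Qed.

Section Resolvent.
Variables al be : R.
Hypothesis Hal : 0 < al.
Hypothesis Hbe : 0 < be.
Let rho2 := al ^ 2 + be ^ 2.
Let k0 := / (4 * al * be * rho2).

(** The characteristic roots are [al + i be] and its images under sign change and conjugation.
    Two of them give the forward kernels [p], [q], the other two the backward kernels [r], [s],
    which are forward kernels of the reflected right-hand side.  The rows of [mx] are the
    coefficients of [p + r], [q + s] for even and of [p - r], [q - s] for odd derivatives; they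
    are chosen such that the source terms cancel in the first three derivatives and add up to
    [v] in the fourth. *)
Lemma resolvent_exists_aux :
  exists C, 0 < C /\ forall v t, bump v -> total v t ->
  exists w, resolvent (2 * (be ^ 2 - al ^ 2)) ((al ^ 2 + be ^ 2) ^ 2) v w /\
    forall k x, (k <= 3)%nat -> Rabs (w k x) <= C * t.
Proof.
  assert (Hrho : 0 < rho2) by (unfold rho2; nra).
  set (mx := fun (k : nat) => match k with
    | 0%nat => (k0 * be, k0 * al) | 1%nat => (0, - rho2 * k0)
    | 2%nat => (- rho2 * k0 * be, rho2 * k0 * al)
    | _ => (2 * al * be * rho2 * k0, (be ^ 2 - al ^ 2) * rho2 * k0) end).
  set (S := fun k => Rabs (fst (mx k)) + Rabs (snd (mx k))).
  assert (HS : forall k, 0 <= S k).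
  { intros k; unfold S; pose proof (Rabs_pos (fst (mx k))); pose proof (Rabs_pos (snd (mx k))); lra. }
  exists (4 * (S 0%nat + S 1%nat + S 2%nat + S 3%nat) + 1); split.
  { pose proof (HS 0%nat); pose proof (HS 1%nat); pose proof (HS 2%nat); pose proof (HS 3%nat); lra. }
  intros v t Hv Ht.
  pose proof (bump_total_nonneg v t Hv Ht) as Ht0.
  destruct (reflect_bump v t Hv Ht) as [Hv' Ht'].
  destruct (forward_kernel al be v t Hal Hv Ht) as (p & q & Dp & Dq & B & (Lp1 & Lq1) & (Lp2 & Lq2)).
  destruct (forward_kernel al be _ t Hal Hv' Ht') as (r0 & s0 & Dr0 & Ds0 & B' & (Lr1 & Ls1) & (Lr2 & Ls2)).
  pose (r := fun x => r0 (- x)). pose (s := fun x => s0 (- x)).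
  assert (Dr : forall x, is_derive r x (al * r x + be * s x - v x)).
  { intros x. eapply D_eq; [apply (D_comp r0); [apply Dr0|apply D_opp, D_id]|].
    unfold r, s. simpl. rewrite Ropp_involutive; ring. }
  assert (Ds : forall x, is_derive s x (al * s x - be * r x)).
  { intros x. eapply D_eq; [apply (D_comp s0); [apply Ds0|apply D_opp, D_id]|].
    unfold r, s. simpl. ring. }
  apply lim_reflect in Lr1. apply lim_reflect in Ls1.
  apply lim_reflect_m in Lr2. apply lim_reflect_m in Ls2.
  fold r in Lr1, Lr2. fold s in Ls1, Ls2.
  assert (Br : forall x, Rabs (r x) <= 2 * t /\ Rabs (s x) <= 2 * t) by (intros x; apply B').
  pose (sg := fun k : nat => if Nat.even k then 1 else -1).
  pose (w := fun k x => fst (mx k) * (1 * p x + sg k * r x) + snd (mx k) * (1 * q x + sg k * s x)).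
  exists w; split; [constructor|].
  - intros k x Hk.
    assert (k = 0 \/ k = 1 \/ k = 2)%nat as [-> | [-> | ->]] by lia;
      unfold w, mx, sg; simpl; prove_derive; unfold k0, rho2; field; unfold rho2 in *; repeat split; nra.
  - intros x. unfold w, mx, sg; simpl. prove_derive. unfold k0, rho2; field; unfold rho2 in *; repeat split; nra.
  - intros k _; repeat first [apply lim_plus0 | apply lim_scal0]; auto.
  - intros k _; repeat first [apply lim_plus0 | apply lim_scal0]; auto.
  - intros k x Hk.
    assert (Rabs (w k x) <= 4 * S k * t).
    { unfold w, S. destruct (B x) as [B1 B2]; destruct (Br x) as [B3 B4].
      assert (G : forall y z, Rabs y <= 2 * t -> Rabs z <= 2 * t -> Rabs (1 * y + sg k * z) <= 4 * t).
      { intros y z Hy Hz. apply Rabs_le_between in Hy. apply Rabs_le_between in Hz. apply Rabs_le_between.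
        unfold sg; destruct (Nat.even k); lra. }
      eapply Rle_trans; [apply Rabs_triang|]. rewrite !Rabs_mult.
      pose proof (G _ _ B1 B3) as G1. pose proof (G _ _ B2 B4) as G2.
      pose proof (Rabs_pos (fst (mx k))); pose proof (Rabs_pos (snd (mx k))). nra. }
    pose proof (HS 0%nat); pose proof (HS 1%nat); pose proof (HS 2%nat); pose proof (HS 3%nat).
    assert (S k <= S 0%nat + S 1%nat + S 2%nat + S 3%nat).
    { assert (k = 0 \/ k = 1 \/ k = 2 \/ k = 3)%nat as [-> | [-> | [-> | ->]]] by lia; lra. }
    nra.
Qed.
End Resolvent.

(** For [c2 < 2 sqrt a] the polynomial [X^4 + c2 X^2 + a] has the four roots
    [+- al +- i be] with [al^2 = (2 sqrt a - c2) / 4] and [be^2 = (2 sqrt a + c2) / 4].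
    The bound in terms of the integral of [v] is what the whole compactness argument
    rests on. *)
Lemma resolvent_exists c2 a : 0 <= c2 -> 0 < a -> c2 ^ 2 < 4 * a ->
  exists C, 0 < C /\ forall v t, bump v -> total v t ->
  exists w, resolvent c2 a v w /\
    forall k x, (k <= 3)%nat -> Rabs (w k x) <= C * t.
Proof.
  intros Hc Ha H.
  pose proof (sqrt_sqrt a (Rlt_le _ _ Ha)) as Hs. pose proof (sqrt_lt_R0 a Ha) as Hp.
  set (s := sqrt a) in *.
  assert (H2 : c2 < 2 * s) by nra.
  assert (P1 : 0 < (2 * s - c2) / 4) by lra.
  assert (P2 : 0 < (2 * s + c2) / 4) by lra.
  pose proof (sqrt_sqrt _ (Rlt_le _ _ P1)) as E1. pose proof (sqrt_sqrt _ (Rlt_le _ _ P2)) as E2.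
  destruct (resolvent_exists_aux (sqrt ((2 * s - c2) / 4)) (sqrt ((2 * s + c2) / 4))) as (C & HC & K);
    try (apply sqrt_lt_R0; auto).
  simpl in K. rewrite !Rmult_1_r, E1, E2 in K.
  exists C; split; auto. intros v t Hv Ht; destruct (K v t Hv Ht) as (w & Hw & Hb).
  exists w; split; auto.
  replace c2 with (2 * ((2 * s + c2) / 4 - (2 * s - c2) / 4)) by field.
  replace a with (((2 * s - c2) / 4 + (2 * s + c2) / 4) * ((2 * s - c2) / 4 + (2 * s + c2) / 4)); auto.
  rewrite <- Hs; field.
Qed.

(** * Green identities and the ascent step *)

Section Green.
Variables c2 a : R.

Lemma res_cont v w k : cont v -> resolvent c2 a v w -> (k <= 3)%nat -> cont (w k).
Proof.
  intros Hv [D D3 _ _] Hk. destruct (Nat.eq_dec k 3) as [->|E].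
  - apply (cont_derive _ _ D3).
  - apply (cont_derive _ (w (S k))). intros x; apply D; lia.
Qed.

Lemma resolvent_minus v w v' w' : resolvent c2 a v w -> resolvent c2 a v' w' ->
  resolvent c2 a (fun x => v x - v' x) (fun k x => w k x - w' k x).
Proof.
  intros [D D3 Lp Lm] [D' D3' Lp' Lm']; constructor.
  - intros k x Hk. apply D_minus; auto.
  - intros x. eapply D_eq; [apply D_minus; auto|]. ring.
  - intros k Hk; apply lim_minus0; auto.
  - intros k Hk; apply lim_minus0; auto.
Qed.

(** Lagrange's identity: [w' L w - w L w'] is the derivative of a bilinear expression in the
    first three derivatives, which vanishes at infinity. *)
Lemma green_symmetric v w v' w' m m' :
  cont v -> cont v' -> resolvent c2 a v w -> resolvent c2 a v' w' ->
  total (fun x => v x * w' 0%nat x) m -> total (fun x => v' x * w 0%nat x) m' -> m = m'.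
Proof.
  intros Cv Cv' Rw Rw' Tm Tm'.
  assert (Z : total (fun x => v x * w' 0%nat x - v' x * w 0%nat x) 0).
  { pose proof (fun k => res_cont v w k Cv Rw) as C.
    pose proof (fun k => res_cont v' w' k Cv' Rw') as C'.
    assert (cont (w 0%nat)) by auto. assert (cont (w' 0%nat)) by auto.
    destruct Rw as [D D3 Lp Lm], Rw' as [D' D3' Lp' Lm'].
    assert (D0 : forall x, is_derive (w 0%nat) x (w 1%nat x)) by auto.
    assert (D1 : forall x, is_derive (w 1%nat) x (w 2%nat x)) by auto.
    assert (D2 : forall x, is_derive (w 2%nat) x (w 3%nat x)) by auto.
    assert (D0' : forall x, is_derive (w' 0%nat) x (w' 1%nat x)) by auto.
    assert (D1' : forall x, is_derive (w' 1%nat) x (w' 2%nat x)) by auto.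
    assert (D2' : forall x, is_derive (w' 2%nat) x (w' 3%nat x)) by auto.
    apply (total_derive (fun x => (w 3%nat x * w' 0%nat x - w 2%nat x * w' 1%nat x)
      + (w 1%nat x * w' 2%nat x - w 0%nat x * w' 3%nat x)
      + c2 * (w 1%nat x * w' 0%nat x - w 0%nat x * w' 1%nat x))).
    - prove_cont.
    - intros x. prove_derive. ring.
    - apply lim_plus0; [apply lim_plus0|apply lim_scal0]; apply lim_minus0; apply lim_mult0; auto.
    - apply lim_plus0; [apply lim_plus0|apply lim_scal0]; apply lim_minus0; apply lim_mult0; auto. }
  pose proof (total_eq _ _ _ _ (total_lin _ _ _ _ 1 (-1) Tm Tm') Z) as E.
  cut (1 * m + -1 * m' = 0); [lra|]. apply E. intros x; ring.
Qed.

(** Integrating [w w''''] by parts twice; the term [w w''] is left alone, so that positivity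
    can be read off pointwise. *)
Lemma green_energy v w p : cont v -> resolvent c2 a v w ->
  total (fun x => v x * w 0%nat x) p ->
  total (fun x => w 2%nat x ^ 2 + c2 * (w 0%nat x * w 2%nat x) + a * w 0%nat x ^ 2) p.
Proof.
  intros Cv Rw Tp.
  pose proof (fun k => res_cont v w k Cv Rw) as C.
  assert (cont (w 0%nat)) by auto. assert (cont (w 2%nat)) by auto.
  destruct Rw as [D D3 Lp Lm].
  assert (D0 : forall x, is_derive (w 0%nat) x (w 1%nat x)) by auto.
  assert (D1 : forall x, is_derive (w 1%nat) x (w 2%nat x)) by auto.
  assert (D2 : forall x, is_derive (w 2%nat) x (w 3%nat x)) by auto.
  assert (Z : total (fun x => v x * w 0%nat x -
     (w 2%nat x ^ 2 + c2 * (w 0%nat x * w 2%nat x) + a * w 0%nat x ^ 2)) 0).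
  { apply (total_derive (fun x => w 3%nat x * w 0%nat x - w 2%nat x * w 1%nat x)).
    - prove_cont.
    - intros x. prove_derive. ring.
    - apply lim_minus0; apply lim_mult0; auto.
    - apply lim_minus0; apply lim_mult0; auto. }
  apply (total_ext _ _ _ _ (total_lin _ _ _ _ 1 (-1) Tp Z)); [intros x|]; ring.
Qed.

(** Completing the square in [z].  The coefficient on the left is positive exactly when
    [c2^2 < 4 a]. *)
Lemma energy_lower u z : (a - c2 ^ 2 / 4) * u ^ 2 <= z ^ 2 + c2 * (u * z) + a * u ^ 2.
Proof. pose proof (pow2_ge_0 (z + c2 / 2 * u)). nra. Qed.

Lemma green_nonneg v w p : c2 ^ 2 < 4 * a -> cont v -> resolvent c2 a v w ->
  total (fun x => v x * w 0%nat x) p -> 0 <= p.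
Proof.
  intros Hca Cv Rw Tp. pose proof (green_energy v w p Cv Rw Tp) as TE.
  apply (total_nonneg _ _ TE).
  intros x. pose proof (energy_lower (w 0%nat x) (w 2%nat x)).
  pose proof (pow2_ge_0 (w 0%nat x)). nra.
Qed.

Lemma green_square_bound v w p x y : c2 ^ 2 < 4 * a -> cont v -> resolvent c2 a v w ->
  total (fun x => v x * w 0%nat x) p -> x <= y ->
  RInt (fun s => w 0%nat s ^ 2) x y <= p / (a - c2 ^ 2 / 4).
Proof.
  intros Hca Cv Rw Tp Hxy. pose proof (green_energy v w p Cv Rw Tp) as TE.
  assert (C0 : cont (w 0%nat)) by (apply (res_cont v w 0); auto; lia).
  assert (C2 : cont (w 2%nat)) by (apply (res_cont v w 2); auto; lia).
  assert (Hd : 0 < a - c2 ^ 2 / 4) by lra.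
  assert (L : RInt (fun s => (a - c2 ^ 2 / 4) * w 0%nat s ^ 2 + 0 * w 0%nat s ^ 2) x y <= p).
  { eapply Rle_trans; [|apply (total_part _ _ x y TE)]; auto.
    - apply RInt_mono; auto; [prove_cont|prove_cont|]. intros s _. pose proof (energy_lower (w 0%nat s) (w 2%nat s)). lra.
    - intros s. pose proof (energy_lower (w 0%nat s) (w 2%nat s)). pose proof (pow2_ge_0 (w 0%nat s)). nra. }
  rewrite RInt_lin in L by prove_cont.
  apply Rmult_le_reg_l with (a - c2 ^ 2 / 4); auto.
  replace ((a - c2 ^ 2 / 4) * (p / (a - c2 ^ 2 / 4))) with p by (field; lra). lra.
Qed.

(** The functional that is maximised.  The a priori bound on [w] is part of the definition, so
    that every competitor for the supremum is controlled by the integral of [v]. *)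
Definition penalized (C0 K mu0 lam : R) (v : R -> R) (f : R) : Prop :=
  exists w t q p, bump v /\ resolvent c2 a v w /\ total v t /\
    (forall k x, (k <= 3)%nat -> Rabs (w k x) <= C0 * t) /\
    total (fun x => v x * v x) q /\ total (fun x => v x * w 0%nat x) p /\
    f = p - q / K - 2 * mu0 * t - 2 / 3 * lam * t ^ 3.

Lemma vanishing_truncation (w : R -> R) mu0 : 0 < mu0 ->
  is_lim w p_infty 0 -> is_lim w m_infty 0 ->
  exists r, 0 <= r /\ forall x, r <= Rabs x -> w x <= mu0.
Proof.
  intros H0 Hp Hm. apply is_lim_spec in Hp, Hm.
  destruct (Hp (mkposreal _ H0)) as [M HM]. destruct (Hm (mkposreal _ H0)) as [N HN].
  simpl in *. exists (Rabs M + Rabs N + 1).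
  pose proof (Rabs_pos M); pose proof (Rabs_pos N).
  split; [lra|]. intros x Hx.
  assert (Rabs (w x - 0) < mu0) as B.
  { unfold Rabs in Hx at 3. destruct (Rcase_abs x).
    - apply HN. pose proof (Rle_abs (- N)). rewrite Rabs_Ropp in *. lra.
    - apply HM. pose proof (Rle_abs M). lra. }
  apply Rabs_lt_between in B. lra.
Qed.

(** The threshold depends on the integral [t] of the truncation that it produces.  As [t]
    grows the truncated integral decreases, so the intermediate value theorem applies between
    0 and the truncated integral at threshold [mu0].  All thresholds are at least [mu0 > 0]
    and [w] vanishes at infinity, so one compact interval carries all the integrals. *)
Lemma threshold_exists K mu0 lam w : 0 < K -> 0 < mu0 -> 0 < lam -> cont w ->
  is_lim w p_infty 0 -> is_lim w m_infty 0 ->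
  exists t, 0 <= t /\ bump (fun x => K * Rmax (w x - (mu0 + lam * t ^ 2)) 0) /\
    total (fun x => K * Rmax (w x - (mu0 + lam * t ^ 2)) 0) t.
Proof.
  intros HK H0 Hl Cw Hp Hm.
  destruct (vanishing_truncation w mu0 H0 Hp Hm) as (r & Hr & Hz).
  set (g := fun m x => K * Rmax (w x - m) 0).
  assert (Cg : forall m, cont (g m)) by (intros m; unfold g; prove_cont).
  set (H := fun m => RInt (g m) (- r) r).
  assert (CH : cont H).
  { apply (cont_lipschitz _ (2 * r * K)); [nra|].
    assert (S : forall x y, H y - H x <= 2 * r * K * Rabs (y - x)).
    { intros x y. unfold H.
      replace (RInt (g y) (- r) r - RInt (g x) (- r) r)
        with (1 * RInt (g y) (- r) r + (-1) * RInt (g x) (- r) r) by ring.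
      rewrite <- RInt_lin by auto.
      replace (2 * r * K * Rabs (y - x)) with ((r - - r) * (K * Rabs (y - x))) by ring.
      rewrite <- RInt_cst. pose proof (Cg x); pose proof (Cg y). apply RInt_mono; [prove_cont|prove_cont|lra|]. intros s _. unfold g.
      pose proof (Rmax_pos_lip (w s - y) (w s - x)) as E.
      replace (w s - y - (w s - x)) with (- (y - x)) in E by ring. rewrite Rabs_Ropp in E.
      apply Rabs_le_between in E. nra. }
    intros x y. apply Rabs_le. split; [|apply S].
    pose proof (S y x) as E. rewrite Rabs_minus_sym in E. lra. }
  assert (Hnn : forall m, 0 <= H m).
  { intros m; apply RInt_nonneg; [apply Cg|lra|]. intros x _; unfold g. pose proof (Rmax_r (w x - m) 0). nra. }
  set (h := fun t => t - H (mu0 + lam * t ^ 2)).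
  assert (Ch : continuity h).
  { intros x. apply continuity_pt_filterlim. revert x. change (cont h). unfold h. prove_cont. }
  set (T := H mu0).
  assert (HT : 0 <= h T).
  { unfold h, T. cut (H (mu0 + lam * H mu0 ^ 2) <= H mu0); [lra|].
    apply RInt_mono; [apply Cg|apply Cg|lra|]. intros x _. unfold g.
    apply Rmult_le_compat_l; [lra|]. apply Rle_max_compat_r.
    pose proof (pow2_ge_0 (H mu0)). nra. }
  assert (Hz0 : h 0 <= 0).
  { unfold h. specialize (Hnn (mu0 + lam * 0 ^ 2)). lra. }
  assert (HT0 : 0 <= T) by apply Hnn.
  destruct (IVT_gen h 0 T 0 Ch) as (t & Ht & E).
  { split; [eapply Rle_trans; [apply Rmin_l|auto]|eapply Rle_trans; [apply HT|apply Rmax_r]]. }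
  rewrite Rmin_left, Rmax_right in Ht by auto.
  assert (Z : forall x, r <= Rabs x -> g (mu0 + lam * t ^ 2) x = 0).
  { intros x Hx; unfold g. rewrite Rmax_right; [ring|].
    specialize (Hz x Hx). pose proof (pow2_ge_0 t). nra. }
  exists t; split; [lra|split].
  - split; [apply Cg|split].
    + intros x. pose proof (Rmax_r (w x - (mu0 + lam * t ^ 2)) 0). nra.
    + exists r; auto.
  - pose proof (total_compact _ r (Cg (mu0 + lam * t ^ 2)) Hr Z) as TC.
    assert (Et : t = RInt (g (mu0 + lam * t ^ 2)) (- r) r) by (unfold h, H in E; lra).
    rewrite <- Et in TC. exact TC.
Qed.

(** Minorise [int v w] by its linearisation at [v], which is legitimate because the
    form is symmetric and nonnegative, and maximise the resulting strictly concave problem: its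
    solution is the truncation [v'].  The pointwise inequality behind [P] is the optimality
    condition, where [v >= 0] enters on the set on which [v'] vanishes; convexity of the cubic
    handles the penalty. *)
Lemma ascent_step C0 K mu0 lam v w t q p f :
  0 < K -> 0 < mu0 -> 0 < lam -> c2 ^ 2 < 4 * a -> 
  (forall v t, bump v -> total v t -> exists w, resolvent c2 a v w /\
    forall k x, (k <= 3)%nat -> Rabs (w k x) <= C0 * t) ->
  bump v -> resolvent c2 a v w -> total v t ->
  total (fun x => v x * v x) q -> total (fun x => v x * w 0%nat x) p ->
  f = p - q / K - 2 * mu0 * t - 2 / 3 * lam * t ^ 3 ->
  exists t' f' d, 0 <= t' /\ 
    (let v' := fun x => K * Rmax (w 0%nat x - (mu0 + lam * t' ^ 2)) 0 in
    total v' t' /\ penalized C0 K mu0 lam v' f' /\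
    total (fun x => (v x - v' x) ^ 2) d) /\ f + d / K <= f'.
Proof.
  intros HK H0 Hl Hca HR Hv Rw Tt Tq Tp ->.
  pose proof (bump_total_nonneg v t Hv Tt) as Ht.
  pose proof (proj1 Hv) as Cv.
  assert (Cw : cont (w 0%nat)) by (apply (res_cont v w 0); auto; lia).
  destruct (threshold_exists K mu0 lam (w 0%nat) HK H0 Hl Cw) as (t' & Ht' & Hv' & Tt').
  { apply (res_lim_p _ _ _ _ Rw); lia. }
  { apply (res_lim_m _ _ _ _ Rw); lia. }
  set (mu := mu0 + lam * t' ^ 2) in *.
  set (v' := fun x => K * Rmax (w 0%nat x - mu) 0) in *.
  pose proof (proj1 Hv') as Cv'.
  destruct (HR v' t' Hv' Tt') as [w' [Rw' Bw']].
  assert (Cw' : cont (w' 0%nat)) by (apply (res_cont v' w' 0); auto; lia).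
  destruct (bump_total_mult v' v' Hv' Cv') as [q' Tq'].
  destruct (bump_total_mult v' _ Hv' Cw') as [p' Tp'].
  destruct (bump_total_mult v' _ Hv' Cw) as [m Tm].
  destruct (bump_total_mult v _ Hv Cw') as [m' Tm'].
  destruct (bump_total_mult v v' Hv Cv') as [s Ts].
  pose proof (green_symmetric v w v' w' m' m Cv Cv' Rw Rw' Tm' Tm) as Em. subst m'.
  assert (Td : total (fun x => (v x - v' x) ^ 2) (q - 2 * s + q')).
  { apply (total_ext _ _ _ _ (total_lin _ _ _ _ 1 1 (total_lin _ _ _ _ 1 (-2) Tq Ts) Tq'));
      [intros x|]; ring. }
  assert (G : 0 <= p - 2 * m + p').
  { apply (green_nonneg (fun x => v x - v' x) (fun k x => w k x - w' k x)); auto.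
    - prove_cont.
    - apply resolvent_minus; auto.
    - apply (total_ext _ _ _ _ (total_lin _ _ _ _ 1 1 (total_lin _ _ _ _ 1 (-1) Tp Tm)
        (total_lin _ _ _ _ (-1) 1 Tm' Tp'))); [intros x|]; ring. }
  assert (P : 2 * (p - m) - 2 * mu * (t - t') - 1 / K * (q - q') + 1 / K * (q - 2 * s + q') <= 0).
  { pose proof (total_lin _ _ _ _ 1 1
      (total_lin _ _ _ _ 1 1 (total_lin _ _ _ _ 2 (-2) Tp Tm) (total_lin _ _ _ _ (-2 * mu) (2 * mu) Tt Tt'))
      (total_lin _ _ _ _ 1 1 (total_lin _ _ _ _ (- / K) (/ K) Tq Tq') (total_lin _ _ _ _ (/ K) 0 Td Td))) as T.
    pose proof (total_lin _ _ _ _ 0 0 Tt Tt) as Z.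
    pose proof (total_le _ _ _ _ T Z) as L. cbv beta in L.
    match type of L with _ -> ?A <= ?B => assert (A <= B) as L' end.
    { apply L. intros x. unfold v'. pose proof (proj1 (proj2 Hv) x) as Hx.
      assert (HK' : / K * K = 1) by (field; lra).
      unfold Rmax; destruct (Rle_dec (w 0%nat x - mu) 0) as [Hn|Hn].
      - apply Rle_trans with (2 * (w 0%nat x - mu) * v x); [|nra]. right; ring.
      - right.  field; lra. }
    unfold Rdiv; lra. }
  exists t', (p' - q' / K - 2 * mu0 * t' - 2 / 3 * lam * t' ^ 3), (q - 2 * s + q').
  split; [auto|split; [split; [auto|split; [|auto]]|]].
  - exists w', t', q', p'. auto 10.
  - assert (cvx : 2 / 3 * lam * t ^ 3 - 2 / 3 * lam * t' ^ 3 >= 2 * lam * t' ^ 2 * (t - t')).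
    { assert (0 <= (t - t') ^ 2 * (t + 2 * t')) by (apply Rmult_le_pos; [apply pow2_ge_0|lra]). nra. }
    unfold mu in P. unfold Rdiv in *. nra.
Qed.
End Green.

(** * Approximate solutions *)

(** [m <= w 0 0] excludes vanishing, and the bound on square integrals excludes profiles
    that do not decay; both survive in the limit [eps -> 0]. *)
Record approx_solution (c2 a K C m mu0 eps : R) (w : nat -> R -> R) (mu : R) : Prop := {
  app_derive : forall k x, (k < 3)%nat -> is_derive (w k) x (w (S k) x);
  app_eq : exists e, (forall x, Rabs (e x) <= eps) /\ forall x, is_derive (w 3%nat) x
      (K * Rmax (w 0%nat x - mu) 0 + e x - c2 * w 2%nat x - a * w 0%nat x);
  app_bound : forall k x, (k <= 3)%nat -> Rabs (w k x) <= C;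
  app_origin : m <= w 0%nat 0;
  app_mu : mu0 <= mu <= C;
  app_square : forall x y, x <= y -> RInt (fun s => w 0%nat s ^ 2) x y <= C
}.

Section Approx.
Variables c2 a C0 K mu0 lam : R.
Hypothesis HC0 : 0 < C0.
Hypothesis HK : 0 < K.
Hypothesis Hmu0 : 0 < mu0.
Hypothesis Hlam : 0 < lam.
Hypothesis Hca : c2 ^ 2 < 4 * a.
Hypothesis Hres : forall v t, bump v -> total v t -> exists w, resolvent c2 a v w /\
    forall k x, (k <= 3)%nat -> Rabs (w k x) <= C0 * t.
Let T0 := 3 * C0 / (2 * lam).

(** A nonnegative value forces [(2/3) lam t^3 <= int v w <= C0 t^2]. *)
Lemma penalized_bounds v w t q p f : bump v -> resolvent c2 a v w -> total v t ->
    (forall k x, (k <= 3)%nat -> Rabs (w k x) <= C0 * t) ->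
    total (fun x => v x * v x) q -> total (fun x => v x * w 0%nat x) p ->
    f = p - q / K - 2 * mu0 * t - 2 / 3 * lam * t ^ 3 -> 0 <= f ->
  0 <= t <= T0 /\ f <= p <= C0 * T0 ^ 2.
Proof.
  intros Hv Rw Tt Bw Tq Tp -> Hf.
  assert (Ht : 0 <= t) by (apply (bump_total_nonneg v); auto).
  assert (Hq : 0 <= q).
  { apply (total_nonneg _ _ Tq); intros x; nra. }
  assert (Hp : p <= C0 * t ^ 2).
  { pose proof (total_le _ _ _ _ Tp (total_lin _ _ _ _ (C0 * t) 0 Tt Tt)) as L. cbv beta in L.
    cut (p <= C0 * t * t + 0 * t); [lra|]. apply L. intros x.
    pose proof (Bw 0%nat x ltac:(lia)) as B. apply Rabs_le_between in B.
    pose proof (proj1 (proj2 Hv) x). nra. }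
  assert (HqK : 0 <= q / K) by (apply Rdiv_le_0_compat; lra).
  assert (Hmt : 0 <= mu0 * t) by nra.
  assert (E : 2 / 3 * lam * T0 = C0) by (unfold T0; field; lra).
  assert (HtT : t <= T0).
  { destruct (Rle_dec t T0) as [|N]; auto. exfalso.
    assert (0 < t) by (unfold T0 in *; assert (0 < 3 * C0 / (2 * lam)) by (apply Rdiv_lt_0_compat; lra); lra).
    assert (0 < 2 / 3 * lam * (t - T0) * t ^ 2) by (apply Rmult_lt_0_compat; [nra|apply pow_lt; auto]).
    nra. }
  assert (t ^ 2 <= T0 ^ 2) by (apply pow_incr; lra).
  assert (0 <= t ^ 3) by (apply pow_le; auto).
  assert (0 <= lam * t ^ 3) by nra.
  split; [lra|]. split; nra.
Qed.

Lemma truncation_lipschitz (w w1 : R -> R) mu B : 0 <= B ->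
  (forall x, is_derive w x (w1 x)) -> (forall x, Rabs (w1 x) <= B) ->
  forall x y, Rabs (K * Rmax (w y - mu) 0 - K * Rmax (w x - mu) 0) <= K * B * Rabs (y - x).
Proof.
  intros HB D Hb x y.
  rewrite <- Rmult_minus_distr_l, Rabs_mult, (Rabs_pos_eq K) by lra. rewrite Rmult_assoc.
  apply Rmult_le_compat_l; [lra|].
  eapply Rle_trans; [apply Rmax_pos_lip|].
  replace (w y - mu - (w x - mu)) with (w y - w x) by ring.
  apply (lipschitz_of_derive w w1); auto.
Qed.

(** Start close to the supremum and perform two ascent steps.  The first one produces a
    Lipschitz function [v1]; the second one gains at most the remaining distance to the
    supremum, so [v1 - v2] is small in L^2, hence uniformly small by
    [lipschitz_square_mass], and it is the error with which the resolvent of [v1] solves the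
    equation. *)
Lemma approx_solutions_exist v0 f0 : 0 < f0 -> penalized c2 a C0 K mu0 lam v0 f0 ->
  exists C m, 0 < C /\ 0 < m /\
    forall eps, 0 < eps -> exists w mu, approx_solution c2 a K C m mu0 eps w mu.
Proof.
  intros Hf0 P0.
  assert (HT0 : 0 < T0) by (unfold T0; apply Rdiv_lt_0_compat; lra).
  set (dl := a - c2 ^ 2 / 4). assert (Hdl : 0 < dl) by (unfold dl; lra).
  set (S := fun f => exists v, penalized c2 a C0 K mu0 lam v f).
  destruct (completeness S) as [fs [Hub Hlub]].
  { exists (C0 * T0 ^ 2). intros f [v (w & t & q & p & Hv & Rw & Tt & Bw & Tq & Tp & E)].
    destruct (Rle_dec 0 f) as [Hf|Hf].
    - destruct (penalized_bounds v w t q p f) as [_ B]; auto; lra.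
    - assert (0 <= C0 * T0 ^ 2) by nra. lra. }
  { exists f0, v0; auto. }
  exists (C0 * T0 + (mu0 + lam * T0 ^ 2) + C0 * T0 ^ 2 / dl), (f0 / (4 * T0)).
  assert (Hq : 0 < C0 * T0 ^ 2 / dl) by (apply Rdiv_lt_0_compat; [apply Rmult_lt_0_compat; [lra|apply pow_lt; lra]|lra]).
  assert (HCT : 0 < C0 * T0) by nra.
  assert (HlT : 0 < lam * T0 ^ 2) by (apply Rmult_lt_0_compat; [lra|apply pow_lt; lra]).
  split; [lra|split; [apply Rdiv_lt_0_compat; lra|]].
  intros eps He.
  set (L := 2 * (K * (C0 * T0))).
  assert (HL : 0 < L) by (unfold L; assert (0 < K * (C0 * T0)) by nra; lra).
  (* The first bound keeps the value positive; the second one is the square mass of a Lipschitz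
     function reaching [eps], halved to leave a strict inequality. *)
  set (eta := Rmin (f0 / 2) (eps ^ 3 / (8 * L) / (2 * K))).
  assert (Heta : 0 < eta).
  { apply Rmin_glb_lt; [lra|]. repeat apply Rdiv_lt_0_compat; try lra. apply pow_lt; auto. }
  assert (Heta1 : eta <= f0 / 2) by apply Rmin_l.
  assert (Heta2 : K * eta < eps ^ 3 / (8 * L)).
  { assert (E : eta <= eps ^ 3 / (8 * L) / (2 * K)) by apply Rmin_r.
    assert (0 < eps ^ 3 / (8 * L)) by (apply Rdiv_lt_0_compat; [apply pow_lt; auto|lra]).
    apply Rle_lt_trans with (K * (eps ^ 3 / (8 * L) / (2 * K))); [apply Rmult_le_compat_l; lra|].
    replace (K * (eps ^ 3 / (8 * L) / (2 * K))) with (eps ^ 3 / (8 * L) / 2) by (field; lra). lra. }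
  assert (Hfs : f0 <= fs) by (apply Hub; exists v0; auto).
  assert (Hnear : exists f v, penalized c2 a C0 K mu0 lam v f /\ fs - eta < f).
  { apply NNPP; intros N.
    assert (fs <= fs - eta); [|lra]. apply Hlub. intros f [v Hv].
    destruct (Rle_dec f (fs - eta)) as [|M]; auto. exfalso; apply N. exists f, v; split; auto; lra. }
  destruct Hnear as (f & v & Pv & Hf).
  destruct Pv as (w & t & q & p & Hv & Rw & Tt & Bw & Tq & Tp & E).
  destruct (penalized_bounds v w t q p f) as [Bt _]; auto; [lra|].
  destruct (ascent_step c2 a C0 K mu0 lam v w t q p f) as (t1 & f1 & d1 & Ht1 & (Tt1 & P1 & Td1) & G1); auto.
  set (v1 := fun x => K * Rmax (w 0%nat x - (mu0 + lam * t1 ^ 2)) 0) in *.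
  assert (Hd1 : 0 <= d1).
  { apply (total_nonneg _ _ Td1); intros x; apply pow2_ge_0. }
  assert (HdK : 0 <= d1 / K) by (apply Rdiv_le_0_compat; lra).
  clear E. destruct P1 as (w1 & t1' & q1 & p1 & Hv1 & Rw1 & Tt1' & Bw1 & Tq1 & Tp1 & E1).
  assert (t1' = t1) by (apply (total_eq _ _ _ _ Tt1' Tt1); auto). subst t1'.
  destruct (penalized_bounds v1 w1 t1 q1 p1 f1) as [Bt1 Bp1]; auto; [lra|].
  destruct (ascent_step c2 a C0 K mu0 lam v1 w1 t1 q1 p1 f1) as (t2 & f2 & d2 & Ht2 & (Tt2 & P2 & Td2) & G2); auto.
  set (v2 := fun x => K * Rmax (w1 0%nat x - (mu0 + lam * t2 ^ 2)) 0) in *.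
  assert (Hf2 : f2 <= fs) by (apply Hub; exists v2; auto).
  assert (HK2 : d2 = K * (d2 / K)) by (field; lra).
  assert (Hd2 : 0 <= d2).
  { apply (total_nonneg _ _ Td2); intros x; apply pow2_ge_0. }
  assert (HdK2 : 0 <= d2 / K) by (apply Rdiv_le_0_compat; lra).
  destruct P2 as (w2 & t2' & q2 & p2 & Hv2 & Rw2 & Tt2' & Bw2 & Tq2 & Tp2 & E2).
  assert (t2' = t2) by (apply (total_eq _ _ _ _ Tt2' Tt2); auto). subst t2'.
  destruct (penalized_bounds v2 w2 t2 q2 p2 f2) as [Bt2 _]; auto; [lra|].
  assert (Hd2' : d2 <= K * eta) by (rewrite HK2; apply Rmult_le_compat_l; lra).
  pose proof (proj1 Hv1) as Cv1. pose proof (proj1 Hv2) as Cv2.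
  set (e := fun x => v1 x - v2 x).
  assert (Lip : forall x y, Rabs (e y - e x) <= L * Rabs (y - x)).
  { intros x y. unfold e.
    replace (v1 y - v2 y - (v1 x - v2 x)) with ((v1 y - v1 x) - (v2 y - v2 x)) by ring.
    eapply Rle_trans; [apply Rabs_triang|]. rewrite Rabs_Ropp.
    assert (Rabs (v1 y - v1 x) <= K * (C0 * T0) * Rabs (y - x)).
    { apply (truncation_lipschitz (w 0%nat) (w 1%nat)); [nra| |].
      - intros z; apply (res_derive _ _ _ _ Rw); lia.
      - intros z; eapply Rle_trans; [apply Bw; lia|]. apply Rmult_le_compat_l; lra. }
    assert (Rabs (v2 y - v2 x) <= K * (C0 * T0) * Rabs (y - x)).
    { apply (truncation_lipschitz (w1 0%nat) (w1 1%nat)); [nra| |].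
      - intros z; apply (res_derive _ _ _ _ Rw1); lia.
      - intros z; eapply Rle_trans; [apply Bw1; lia|]. apply Rmult_le_compat_l; lra. }
    unfold L. lra. }
  assert (small : forall x, Rabs (e x) <= eps).
  { intros x. destruct (Rle_dec (Rabs (e x)) eps) as [|N]; auto. exfalso.
    assert (Ce : cont e) by (unfold e; prove_cont).
    pose proof (lipschitz_square_mass e L x eps Ce HL He Lip) as M.
    assert (RInt (fun y => e y ^ 2) x (x + eps / (2 * L)) <= d2).
    { apply total_part; auto.
      - intros y _; apply pow2_ge_0.
      - assert (0 < eps / (2 * L)) by (apply Rdiv_lt_0_compat; lra). lra. }
    assert (eps ^ 3 / (8 * L) <= RInt (fun y => e y ^ 2) x (x + eps / (2 * L))) by (apply M; lra).
    lra. }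
  assert (Hx0 : exists x0, f0 / (4 * T0) <= w1 0%nat x0).
  { apply NNPP; intros N.
    pose proof (total_le _ _ _ _ Tp1 (total_lin _ _ _ _ (f0 / (4 * T0)) 0 Tt1 Tt1)) as Q. cbv beta in Q.
    assert (p1 <= f0 / (4 * T0) * t1 + 0 * t1).
    { apply Q. intros x. assert (w1 0%nat x < f0 / (4 * T0)).
      { apply Rnot_le_lt; intros M; apply N; exists x; auto. }
      pose proof (proj1 (proj2 Hv1) x). nra. }
    assert (f0 / (4 * T0) * t1 <= f0 / (4 * T0) * T0).
    { apply Rmult_le_compat_l; [|lra]. left; apply Rdiv_lt_0_compat; lra. }
    replace (f0 / (4 * T0) * T0) with (f0 / 4) in * by (field; lra). lra. }
  destruct Hx0 as [x0 Hx0].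
  assert (Cw10 : cont (w1 0%nat)) by (apply (res_cont c2 a v1 w1 0); auto; lia).
  exists (fun k x => w1 k (x + x0)), (mu0 + lam * t2 ^ 2).
  assert (t2 ^ 2 <= T0 ^ 2) by (apply pow_incr; lra).
  pose proof (pow2_ge_0 t2).
  constructor.
  - intros k x Hk. apply D_translate. apply (res_derive _ _ _ _ Rw1); auto.
  - exists (fun x => e (x + x0)). split; [auto|]. intros x.
    apply (D_translate (w1 3%nat)). eapply D_eq; [apply (res_derive3 _ _ _ _ Rw1)|].
    unfold e, v2. ring.
  - intros k x Hk. eapply Rle_trans; [apply Bw1; auto|].
    assert (C0 * t1 <= C0 * T0) by (apply Rmult_le_compat_l; lra). lra.
  - rewrite Rplus_0_l; auto.
  - split; nra.
  - intros x y Hxy. rewrite (RInt_translate (fun s => w1 0%nat s ^ 2)) by prove_cont.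
    eapply Rle_trans; [apply (green_square_bound c2 a v1 w1 p1); auto; lra|]. fold dl.
    assert (p1 / dl <= C0 * T0 ^ 2 / dl).
    { apply Rmult_le_compat_r; [left; apply Rinv_0_lt_compat; auto|lra]. }
    lra.
Qed.
End Approx.

(** * Passage to the limit *)

(** Take for [l] the upper limit of the values of [f] as [eps -> 0]. *)
Lemma cluster_value (X : Type) (Q : R -> X -> Prop) (f : X -> R) B :
  (forall eps eps' x, eps <= eps' -> Q eps x -> Q eps' x) ->
  (forall eps, 0 < eps -> exists x, Q eps x) ->
  (forall x, Q 1 x -> Rabs (f x) <= B) ->
  exists l, forall eps, 0 < eps -> exists x, Q eps x /\ Rabs (f x - l) <= eps.
Proof.
  intros Hm Hne Hb.
  set (S := fun y => forall eps, 0 < eps -> exists x, Q eps x /\ y <= f x).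
  destruct (completeness S) as [l [Hub Hlub]].
  - exists B. intros y Hy. destruct (Hy 1 Rlt_0_1) as (x & Qx & Hx).
    specialize (Hb x Qx). apply Rabs_le_between in Hb. lra.
  - exists (- B). intros eps He.
    destruct (Hne (Rmin eps 1)) as [x Qx]; [apply Rmin_glb_lt; lra|].
    exists x; split; [apply (Hm (Rmin eps 1)); auto; apply Rmin_l|].
    assert (Q1 : Q 1 x) by (apply (Hm (Rmin eps 1)); auto; apply Rmin_r).
    specialize (Hb x Q1). apply Rabs_le_between in Hb. lra.
  - exists l. intros eps He.
    assert (H1 : exists y, S y /\ l - eps < y).
    { apply NNPP; intros N. assert (l <= l - eps); [|lra]. apply Hlub. intros y Hy.
      destruct (Rle_dec y (l - eps)) as [|M]; auto. exfalso; apply N; exists y; split; auto; lra. }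
    assert (H2 : exists e0, 0 < e0 /\ forall x, Q e0 x -> f x < l + eps).
    { apply NNPP; intros N. assert (l + eps <= l); [|lra]. apply Hub. intros e0 He0.
      apply NNPP; intros N'. apply N. exists e0; split; auto. intros x Qx.
      apply Rnot_le_lt; intros M; apply N'; exists x; auto. }
    destruct H1 as (y & Sy & Hy), H2 as (e0 & He0 & Hlt).
    destruct (Sy (Rmin eps e0)) as (x & Qx & Hx); [apply Rmin_glb_lt; lra|].
    exists x; split; [apply (Hm (Rmin eps e0)); auto; apply Rmin_l|].
    assert (f x < l + eps) by (apply Hlt, (Hm (Rmin eps e0)); auto; apply Rmin_r).
    apply Rabs_le; lra.
Qed.

Lemma cluster_values (X : Type) (Q : R -> X -> Prop) (f : nat -> X -> R) B n :
  (forall eps eps' x, eps <= eps' -> Q eps x -> Q eps' x) ->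
  (forall eps, 0 < eps -> exists x, Q eps x) ->
  (forall k x, (k < n)%nat -> Q 1 x -> Rabs (f k x) <= B) ->
  exists l : nat -> R, forall eps, 0 < eps ->
    exists x, Q eps x /\ forall k, (k < n)%nat -> Rabs (f k x - l k) <= eps.
Proof.
  intros Hm Hne. induction n as [|n IH]; intros Hb.
  - exists (fun _ => 0). intros eps He. destruct (Hne eps He) as [x Qx].
    exists x; split; auto. intros; lia.
  - destruct IH as [l Hl]; [intros; apply Hb; auto|].
    destruct (cluster_value X
      (fun eps x => Q eps x /\ forall k, (k < n)%nat -> Rabs (f k x - l k) <= eps) (f n) B) as [ln Hln].
    + intros eps eps' x Hle [Qx Hx]; split; [apply (Hm eps); auto|].
      intros k Hk; eapply Rle_trans; [apply Hx; auto|auto].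
    + auto.
    + intros x [Qx _]; apply Hb; auto.
    + exists (fun k => if Nat.eq_dec k n then ln else l k). intros eps He.
      destruct (Hln eps He) as (x & [Qx Hx] & Hn). exists x; split; auto.
      intros k Hk. destruct (Nat.eq_dec k n) as [->|Ne]; auto. apply Hx; lia.
Qed.

(** [(N + h) exp (- L x)] is nonincreasing for [x >= 0] because [h <= L h]; negative [x] follow
    by reflection. *)
Lemma gronwall N N' L h x : (forall y, is_derive N y (N' y)) ->
  (forall y, 0 <= N y) -> 1 <= L -> 0 <= h ->
  (forall y, Rabs (N' y) <= L * N y + h) -> N x <= (N 0 + h) * exp (L * Rabs x).
Proof.
  intros D Hp HL Hh Hb.
  assert (G : forall M M' y, (forall y, is_derive M y (M' y)) -> (forall y, 0 <= M y) ->
     (forall y, Rabs (M' y) <= L * M y + h) -> 0 <= y -> M y <= (M 0 + h) * exp (L * y)).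
  { clear x N N' D Hp Hb. intros M M' y D Hp Hb Hy.
    set (phi := fun z => - ((M z + h) * exp (- (L * z)))).
    assert (I : phi 0 <= phi y).
    { apply (nondecreasing_of_derive phi (fun z => (L * (M z + h) - M' z) * exp (- (L * z)))); auto.
      - intros z _. unfold phi. prove_derive. ring.
      - intros z _. apply Rmult_le_pos; [|left; apply exp_pos].
        specialize (Hb z). apply Rabs_le_between in Hb. nra. }
    unfold phi in I. rewrite Rmult_0_r, Ropp_0, exp_0 in I.
    rewrite exp_Ropp in I. pose proof (exp_pos (L * y)) as E.
    assert (J : (M y + h) * / exp (L * y) <= M 0 + h) by lra.
    apply Rmult_le_compat_r with (r := exp (L * y)) in J; [|lra].
    rewrite Rmult_assoc, Rinv_l in J by lra. lra. }
  unfold Rabs; destruct (Rcase_abs x) as [Hx|Hx].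
  - replace (N x) with ((fun z => N (- z)) (- x)) by (simpl; f_equal; ring).
    replace (N 0) with (N (- 0)) by (f_equal; ring).
    apply (G (fun z => N (- z)) (fun z => - N' (- z))); auto; [|intros y; rewrite Rabs_Ropp; auto|lra].
    intros y. eapply D_eq; [apply (D_comp N); [apply D|apply D_opp, D_id]|ring].
  - apply (G N N'); auto; lra.
Qed.

Lemma inv_succ_pos n : 0 < / (INR n + 1).
Proof. apply Rinv_0_lt_compat. pose proof (pos_INR n). lra. Qed.

Lemma inv_succ_small eps : 0 < eps -> exists n, / (INR n + 1) <= eps.
Proof.
  intros He. destruct (INR_unbounded (/ eps)) as [n Hn]. exists n.
  rewrite <- (Rinv_inv eps). apply Rinv_le_contravar; [apply Rinv_0_lt_compat; auto|lra].
Qed.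

Lemma inv_succ_le n m : (n <= m)%nat -> / (INR m + 1) <= / (INR n + 1).
Proof.
  intros H. apply Rinv_le_contravar; [pose proof (pos_INR n); lra|]. apply le_INR in H; lra.
Qed.

Lemma le_of_inv_succ x y B : (forall n, x <= y + B * / (INR n + 1)) -> x <= y.
Proof.
  intros H. apply Rnot_lt_le; intros Hlt.
  destruct (inv_succ_small ((x - y) / (2 * (Rabs B + 1)))) as [n Hn].
  { apply Rdiv_lt_0_compat; [lra|]. pose proof (Rabs_pos B); lra. }
  specialize (H n). pose proof (inv_succ_pos n). pose proof (Rabs_pos B). pose proof (Rle_abs B).
  assert ((Rabs B + 1) * / (INR n + 1) <= (Rabs B + 1) * ((x - y) / (2 * (Rabs B + 1)))) by (apply Rmult_le_compat_l; lra).
  replace ((Rabs B + 1) * ((x - y) / (2 * (Rabs B + 1)))) with ((x - y) / 2) in * by (field; lra).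
  nra.
Qed.

Lemma cauchy_rate (u : nat -> R) B :
  (forall n m, (n <= m)%nat -> Rabs (u n - u m) <= B * / (INR n + 1)) ->
  exists l, forall n, Rabs (u n - l) <= B * / (INR n + 1).
Proof.
  intros H.
  assert (HB : 0 <= B).
  { pose proof (H 0%nat 0%nat (le_n _)) as H0. pose proof (Rabs_pos (u 0%nat - u 0%nat)).
    simpl in H0. rewrite Rplus_0_l, Rinv_1 in H0. lra. }
  assert (E : ex_finite_lim_seq u).
  { apply ex_lim_seq_cauchy_corr. intros [eps He]; simpl.
    destruct (inv_succ_small (eps / (2 * (B + 1)))) as [N HN]; [apply Rdiv_lt_0_compat; lra|].
    assert (S : forall n m, (N <= n)%nat -> (n <= m)%nat -> Rabs (u n - u m) < eps).
    { intros n m Hn Hm. eapply Rle_lt_trans; [apply H; auto|].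
      pose proof (inv_succ_le N n Hn). pose proof (inv_succ_pos n).
      assert (B * / (INR n + 1) <= B * (eps / (2 * (B + 1)))) by (apply Rmult_le_compat_l; lra).
      assert ((B + 1) * (eps / (2 * (B + 1))) = eps / 2) by (field; lra).
      assert (0 < eps / (2 * (B + 1))) by (apply Rdiv_lt_0_compat; lra). lra. }
    exists N. intros n m Hn Hm. destruct (Nat.le_ge_cases n m); auto.
    rewrite Rabs_minus_sym; auto. }
  destruct E as [l Hl]. exists l. intros n.
  apply is_lim_seq_spec in Hl.
  apply Rle_plus_epsilon. intros eps He.
  destruct (Hl (mkposreal _ He)) as [N HN]; simpl in HN.
  specialize (HN (n + N)%nat ltac:(lia)). specialize (H n (n + N)%nat ltac:(lia)).
  replace (u n - l) with ((u n - u (n + N)%nat) + (u (n + N)%nat - l)) by ring.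
  eapply Rle_trans; [apply Rabs_triang|]. lra.
Qed.

(** The derivatives are equi-Lipschitz up to an error that tends to 0, so the remainder in the
    first order expansion is quadratic uniformly in [n]; pointwise convergence is then enough
    to pass to the limit. *)
Lemma derive_of_limit (fn gn : nat -> R -> R) (f g rf rg : R -> R) C B : 0 <= C ->
  (forall n x, is_derive (fn n) x (gn n x)) ->
  (forall n x y, Rabs (gn n y - gn n x) <= C * Rabs (y - x) + B * / (INR n + 1)) ->
  (forall n x, Rabs (fn n x - f x) <= rf x * / (INR n + 1)) ->
  (forall n x, Rabs (gn n x - g x) <= rg x * / (INR n + 1)) ->
  forall x, is_derive f x (g x).
Proof.
  intros HC D HL Hf Hg x.
  assert (Q : forall h, Rabs (f (x + h) - f x - g x * h) <= C * Rabs h * Rabs h).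
  { intros h. apply (le_of_inv_succ _ _ (rf (x + h) + rf x + (rg x + B) * Rabs h)). intros n.
    destruct (mean_value (fn n) (gn n) x (x + h) (D n)) as [z [Hz E]].
    replace (x + h - x) with h in E by ring.
    replace (f (x + h) - f x - g x * h) with
      (- (fn n (x + h) - f (x + h)) + (fn n x - f x) + (gn n x - g x) * h + (gn n z - gn n x) * h)
      by lra.
    pose proof (Hf n (x + h)) as A1. pose proof (Hf n x) as A2. pose proof (Hg n x) as A3.
    pose proof (HL n x z) as A4.
    assert (A5 : Rabs (z - x) <= Rabs h).
    { unfold Rmin, Rmax in Hz. unfold Rabs. destruct (Rle_dec x (x + h));
      repeat destruct Rcase_abs; lra. }
    pose proof (Rabs_pos h) as Hh.
    eapply Rle_trans; [apply Rabs_triang|]. eapply Rle_trans; [apply Rplus_le_compat_r, Rabs_triang|].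
    eapply Rle_trans; [apply Rplus_le_compat_r, Rplus_le_compat_r, Rabs_triang|].
    rewrite Rabs_Ropp, !Rabs_mult.
    assert (Rabs (gn n x - g x) * Rabs h <= rg x * / (INR n + 1) * Rabs h) by (apply Rmult_le_compat_r; auto).
    assert (Rabs (gn n z - gn n x) * Rabs h <= (C * Rabs h + B * / (INR n + 1)) * Rabs h).
    { apply Rmult_le_compat_r; auto. eapply Rle_trans; [apply A4|].
      apply Rplus_le_compat_r. apply Rmult_le_compat_l; auto. }
    lra. }
  apply is_derive_Reals. intros eps He.
  assert (Hd : 0 < eps / (C + 1)) by (apply Rdiv_lt_0_compat; lra).
  exists (mkposreal _ Hd). intros h Hh0 Hh. simpl in Hh.
  replace ((f (x + h) - f x) / h - g x) with ((f (x + h) - f x - g x * h) / h) by (field; auto).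
  unfold Rdiv. rewrite Rabs_mult, Rabs_inv.
  assert (Hhp : 0 < Rabs h) by (apply Rabs_pos_lt; auto).
  apply Rle_lt_trans with (C * Rabs h).
  - apply Rmult_le_reg_r with (Rabs h); auto. rewrite Rmult_assoc, Rinv_l by lra. specialize (Q h). lra.
  - assert ((C + 1) * (eps / (C + 1)) = eps) by (field; lra).
    nra.
Qed.

Section Limit.
Variables c2 a K C m mu0 : R.
Hypothesis Hc2 : 0 <= c2.
Hypothesis Ha : 0 <= a.
Hypothesis HK : 0 <= K.
Hypothesis HC : 0 <= C.
Hypothesis Hmu0 : 0 <= mu0.
Let approx := approx_solution c2 a K C m mu0.
Let L := 4 + K + c2 + a.

(** The nonlinearity is Lipschitz in [w] and in the threshold, so the squared distance of two
    approximate solutions obeys a linear differential inequality. *)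
Lemma approx_distance eps eps' w mu w' mu' x :
  approx eps w mu -> approx eps' w' mu' ->
  let N := fun x => (w 0%nat x - w' 0%nat x) ^ 2 + (w 1%nat x - w' 1%nat x) ^ 2
    + (w 2%nat x - w' 2%nat x) ^ 2 + (w 3%nat x - w' 3%nat x) ^ 2 in
  N x <= (N 0 + (K ^ 2 * (mu - mu') ^ 2 + (eps + eps') ^ 2)) * exp (L * Rabs x).
Proof.
  intros [D (e & He & D3) _ _ _ _] [D' (e' & He' & D3') _ _ _ _] N.
  assert (D0 : forall x, is_derive (w 0%nat) x (w 1%nat x)) by auto.
  assert (D1 : forall x, is_derive (w 1%nat) x (w 2%nat x)) by auto.
  assert (D2 : forall x, is_derive (w 2%nat) x (w 3%nat x)) by auto.
  assert (D0' : forall x, is_derive (w' 0%nat) x (w' 1%nat x)) by auto.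
  assert (D1' : forall x, is_derive (w' 1%nat) x (w' 2%nat x)) by auto.
  assert (D2' : forall x, is_derive (w' 2%nat) x (w' 3%nat x)) by auto.
  apply (gronwall N (fun x => 
     2 * ((w 0%nat x - w' 0%nat x) * (w 1%nat x - w' 1%nat x)
       + (w 1%nat x - w' 1%nat x) * (w 2%nat x - w' 2%nat x)
       + (w 2%nat x - w' 2%nat x) * (w 3%nat x - w' 3%nat x)
       + (w 3%nat x - w' 3%nat x) * (K * (Rmax (w 0%nat x - mu) 0 - Rmax (w' 0%nat x - mu') 0)
            + (e x - e' x) - c2 * (w 2%nat x - w' 2%nat x) - a * (w 0%nat x - w' 0%nat x))))).
  - intros y. unfold N. prove_derive. ring.
  - intros y. unfold N.
    pose proof (pow2_ge_0 (w 0%nat y - w' 0%nat y)); pose proof (pow2_ge_0 (w 1%nat y - w' 1%nat y)).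
    pose proof (pow2_ge_0 (w 2%nat y - w' 2%nat y)); pose proof (pow2_ge_0 (w 3%nat y - w' 3%nat y)). lra.
  - unfold L; lra.
  - pose proof (pow2_ge_0 (K * (mu - mu'))); pose proof (pow2_ge_0 (eps + eps')). nra.
  - intros y. unfold N.
    set (d0 := w 0%nat y - w' 0%nat y). set (d1 := w 1%nat y - w' 1%nat y).
    set (d2 := w 2%nat y - w' 2%nat y). set (d3 := w 3%nat y - w' 3%nat y).
    assert (Hde : (e y - e' y) ^ 2 <= (eps + eps') ^ 2).
    { specialize (He y). specialize (He' y). rewrite <- (pow2_abs (e y - e' y)). apply pow_incr.
      split; [apply Rabs_pos|]. eapply Rle_trans; [apply Rabs_triang|]. rewrite Rabs_Ropp; lra. }
    set (de := e y - e' y) in *.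
    assert (HP : Rabs (Rmax (w 0%nat y - mu) 0 - Rmax (w' 0%nat y - mu') 0) <= Rabs d0 + Rabs (mu - mu')).
    { eapply Rle_trans; [apply Rmax_pos_lip|].
      replace (w 0%nat y - mu - (w' 0%nat y - mu')) with (d0 + - (mu - mu')) by (unfold d0; ring).
      eapply Rle_trans; [apply Rabs_triang|]. rewrite Rabs_Ropp; lra. }
    set (P := Rmax (w 0%nat y - mu) 0 - Rmax (w' 0%nat y - mu') 0) in *.
    set (dm := mu - mu') in *.
    assert (Q : forall u v, Rabs (2 * (u * v)) <= u ^ 2 + v ^ 2).
    { intros u v. apply Rabs_le. pose proof (pow2_ge_0 (u - v)); pose proof (pow2_ge_0 (u + v)). nra. }
    assert (QP : Rabs (2 * (d3 * (K * P))) <= K * (d3 ^ 2 + d0 ^ 2) + d3 ^ 2 + K ^ 2 * dm ^ 2).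
    { rewrite !Rabs_mult, (Rabs_pos_eq 2), (Rabs_pos_eq K) by lra.
      rewrite <- (pow2_abs d3), <- (pow2_abs d0), <- (pow2_abs dm).
      pose proof (Rabs_pos d3); pose proof (Rabs_pos d0); pose proof (Rabs_pos dm).
      apply Rle_trans with (2 * (Rabs d3 * (K * (Rabs d0 + Rabs dm)))).
      - apply Rmult_le_compat_l; [lra|]. apply Rmult_le_compat_l; auto. apply Rmult_le_compat_l; auto.
      - assert (0 <= K * (Rabs d3 - Rabs d0) ^ 2) by (apply Rmult_le_pos; auto; apply pow2_ge_0).
        pose proof (pow2_ge_0 (Rabs d3 - K * Rabs dm)). nra. }
    pose proof (Q d0 d1) as Q1. pose proof (Q d1 d2) as Q2. pose proof (Q d2 d3) as Q3.
    pose proof (Q d3 de) as Q4. pose proof (Q d3 d2) as Q5. pose proof (Q d3 d0) as Q6.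
    apply Rabs_le_between in QP, Q1, Q2, Q3, Q4, Q5, Q6.
    assert (C5 : - (c2 * (d3 ^ 2 + d2 ^ 2)) <= c2 * (2 * (d3 * d2)) <= c2 * (d3 ^ 2 + d2 ^ 2)) by nra.
    assert (C6 : - (a * (d3 ^ 2 + d0 ^ 2)) <= a * (2 * (d3 * d0)) <= a * (d3 ^ 2 + d0 ^ 2)) by nra.
    pose proof (pow2_ge_0 d0); pose proof (pow2_ge_0 d1); pose proof (pow2_ge_0 d2); pose proof (pow2_ge_0 d3).
    assert (0 <= K * d0 ^ 2) by nra. assert (0 <= K * d1 ^ 2) by nra. assert (0 <= K * d2 ^ 2) by nra.
    assert (0 <= c2 * d0 ^ 2) by nra. assert (0 <= c2 * d1 ^ 2) by nra.
    assert (0 <= a * d1 ^ 2) by nra. assert (0 <= a * d2 ^ 2) by nra.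
    assert (0 <= K * d3 ^ 2) by nra. assert (0 <= c2 * d3 ^ 2) by nra. assert (0 <= a * d3 ^ 2) by nra.
    apply Rabs_le. unfold L. split; lra.
Qed.

Lemma approx_deriv3_bound eps w mu : approx eps w mu -> eps <= 1 ->
  exists f, (forall x, is_derive (w 3%nat) x (f x)) /\
    forall x, Rabs (f x) <= (K + c2 + a) * C + 1.
Proof.
  intros [D (e & He & D3) B _ Hmu _] Heps.
  eexists; split; [apply D3|]. intros x; simpl.
  specialize (He x). pose proof (B 0%nat x ltac:(lia)) as B0. pose proof (B 2%nat x ltac:(lia)) as B2.
  assert (P : 0 <= Rmax (w 0%nat x - mu) 0 <= C).
  { split; [apply Rmax_r|]. apply Rabs_le_between in B0. apply Rmax_lub; lra. }
  apply Rabs_le_between in He, B0, B2.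
  apply Rabs_le. nra.
Qed.

(** Choose a cluster point of the four Cauchy data at 0 and of the threshold as the error
    tends to 0.  By [approx_distance] the solutions along a sequence approaching it are
    Cauchy at every point, with rate [rho x / (n + 1)]. *)
Lemma limit_solution : (forall eps, 0 < eps -> exists w mu, approx eps w mu) ->
  exists W mu, (forall k x, (k < 3)%nat -> is_derive (W k) x (W (S k) x)) /\
    (forall x, is_derive (W 3%nat) x
       (K * Rmax (W 0%nat x - mu) 0 - c2 * W 2%nat x - a * W 0%nat x)) /\
    (forall k x, (k <= 3)%nat -> Rabs (W k x) <= C) /\
    m <= W 0%nat 0 /\ mu0 <= mu /\
    (forall x y, x <= y -> RInt (fun s => W 0%nat s ^ 2) x y <= C).
Proof.
  intros Hex.
  destruct (cluster_values ((nat -> R -> R) * R)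
    (fun eps s => approx eps (fst s) (snd s))
    (fun k s => match k with 4%nat => snd s | _ => fst s k 0 end) C 5) as [l Hl].
  { intros eps eps' [w mu] Hle [D (e & He & D3) B O M Sq]; simpl in *.
    constructor; auto. exists e; split; auto. intros x; specialize (He x); lra. }
  { intros eps He. destruct (Hex eps He) as (w & mu & H). exists (w, mu); auto. }
  { intros k [w mu] Hk [D E B O M Sq]; simpl in *.
    assert (k = 0 \/ k = 1 \/ k = 2 \/ k = 3 \/ k = 4)%nat as [-> | [-> | [-> | [-> | ->]]]] by lia;
      try (apply B; lia). rewrite Rabs_pos_eq; lra. }
  assert (Hseq : forall n : nat, exists s, approx (/ (INR n + 1)) (fst s) (snd s) /\
     (forall k, (k <= 3)%nat -> Rabs (fst s k 0 - l k) <= / (INR n + 1)) /\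
     Rabs (snd s - l 4%nat) <= / (INR n + 1)).
  { intros n. destruct (Hl _ (inv_succ_pos n)) as (s & A & B). exists s; split; auto. split.
    - intros k Hk. specialize (B k ltac:(lia)).
      assert (k = 0 \/ k = 1 \/ k = 2 \/ k = 3)%nat as [-> | [-> | [-> | ->]]] by lia; auto.
    - apply (B 4%nat); lia. }
  set (s := fun n => proj1_sig (constructive_indefinite_description _ (Hseq n))).
  assert (Hs : forall n, approx (/ (INR n + 1)) (fst (s n)) (snd (s n)) /\
     (forall k, (k <= 3)%nat -> Rabs (fst (s n) k 0 - l k) <= / (INR n + 1)) /\
     Rabs (snd (s n) - l 4%nat) <= / (INR n + 1)).
  { intros n; unfold s. apply (proj2_sig (constructive_indefinite_description _ (Hseq n))). }
  clearbody s.
  set (w := fun n => fst (s n)) in *. set (mu := fun n => snd (s n)) in *.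
  (* [(5 + 2 K)^2] dominates the constant [20 + 4 K^2] that comes from four Cauchy data, the
     threshold and the error, each within [2 / (n + 1)]. *)
  set (rho := fun x => (5 + 2 * K) * exp (L * Rabs x)).
  assert (Hrho : forall x, 0 < rho x).
  { intros x; unfold rho. pose proof (exp_pos (L * Rabs x)). nra. }
  assert (HLp : 0 < L) by (unfold L; lra).
  assert (Hcau : forall k x n p, (k <= 3)%nat -> (n <= p)%nat ->
      Rabs (w n k x - w p k x) <= rho x * / (INR n + 1)).
  { intros k x n p Hk Hnp.
    destruct (Hs n) as (A & B & M). destruct (Hs p) as (A' & B' & M').
    fold (w n) (mu n) in A, B, M. fold (w p) (mu p) in A', B', M'.
    pose proof (inv_succ_le n p Hnp) as Hle. pose proof (inv_succ_pos p) as Hpp.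
    pose proof (approx_distance _ _ _ _ _ _ x A A') as G. cbv zeta beta in G.
    set (dn := / (INR n + 1)) in *. set (dp := / (INR p + 1)) in *.
    assert (sq : forall u z, Rabs u <= dn -> Rabs z <= dp -> (u - z) ^ 2 <= 4 * dn ^ 2).
    { intros u z Hu Hz. apply Rabs_le_between in Hu, Hz. nra. }
    assert (sqk : forall k, (k <= 3)%nat -> (w n k 0 - w p k 0) ^ 2 <= 4 * dn ^ 2).
    { intros j Hj. replace (w n j 0 - w p j 0) with ((w n j 0 - l j) - (w p j 0 - l j)) by ring. auto. }
    assert (sqm : (mu n - mu p) ^ 2 <= 4 * dn ^ 2).
    { replace (mu n - mu p) with ((mu n - l 4%nat) - (mu p - l 4%nat)) by ring. auto. }
    pose proof (sqk 0%nat ltac:(lia)) as s0. pose proof (sqk 1%nat ltac:(lia)) as s1.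
    pose proof (sqk 2%nat ltac:(lia)) as s2. pose proof (sqk 3%nat ltac:(lia)) as s3.
    set (E := exp (L * Rabs x)) in *.
    assert (HE : 1 <= E).
    { unfold E. rewrite <- exp_0. destruct (Rle_lt_or_eq_dec 0 (L * Rabs x)) as [Hlt|Heq].
      - apply Rmult_le_pos; [lra|apply Rabs_pos].
      - left; apply exp_increasing; auto.
      - rewrite <- Heq; lra. }
    assert (T : (w n k x - w p k x) ^ 2 <= ((5 + 2 * K) * E * dn) ^ 2).
    { apply Rle_trans with ((20 + 4 * K ^ 2) * dn ^ 2 * E).
      - eapply Rle_trans; [|eapply Rle_trans; [apply G|]].
        + pose proof (pow2_ge_0 (w n 0%nat x - w p 0%nat x)); pose proof (pow2_ge_0 (w n 1%nat x - w p 1%nat x)).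
          pose proof (pow2_ge_0 (w n 2%nat x - w p 2%nat x)); pose proof (pow2_ge_0 (w n 3%nat x - w p 3%nat x)).
          assert (k = 0 \/ k = 1 \/ k = 2 \/ k = 3)%nat as [-> | [-> | [-> | ->]]] by lia; lra.
        + apply Rmult_le_compat_r; [lra|].
          assert (K ^ 2 * (mu n - mu p) ^ 2 <= K ^ 2 * (4 * dn ^ 2)) by (apply Rmult_le_compat_l; [apply pow2_ge_0|auto]).
          assert ((dn + dp) ^ 2 <= 4 * dn ^ 2) by nra. lra.
      - replace (((5 + 2 * K) * E * dn) ^ 2) with ((5 + 2 * K) ^ 2 * dn ^ 2 * (E * E)) by ring.
        pose proof (pow2_ge_0 dn). 
        apply Rmult_le_compat; [|lra| |nra].
        + apply Rmult_le_pos; [nra|auto].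
        + apply Rmult_le_compat_r; [auto|nra]. }
    unfold rho. fold E. apply Rabs_le.
    assert (0 <= (5 + 2 * K) * E * dn) by (apply Rmult_le_pos; [nra|lra]).
    split; apply Rnot_lt_le; intros Hlt; nra. }
  assert (Hlim : forall k x, exists z, (k <= 3)%nat -> forall n, Rabs (w n k x - z) <= rho x * / (INR n + 1)).
  { intros k x. destruct (Compare_dec.le_dec k 3) as [Hk|Hk].
    - destruct (cauchy_rate (fun n => w n k x) (rho x)) as [z Hz]; [auto|]. exists z; auto.
    - exists 0; intros; lia. }
  set (W := fun k x => proj1_sig (constructive_indefinite_description _ (Hlim k x))).
  assert (HW : forall k x n, (k <= 3)%nat -> Rabs (w n k x - W k x) <= rho x * / (INR n + 1)).
  { intros k x n Hk; unfold W. apply (proj2_sig (constructive_indefinite_description _ (Hlim k x)) Hk). }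
  clearbody W.
  assert (Happ : forall n, approx (/ (INR n + 1)) (w n) (mu n)) by (intros n; apply Hs).
  assert (Hmu : forall n, Rabs (mu n - l 4%nat) <= / (INR n + 1)) by (intros n; apply Hs).
  assert (Hle1 : forall n, / (INR n + 1) <= 1).
  { intros n. pose proof (inv_succ_le 0 n ltac:(lia)) as H. simpl in H. rewrite Rplus_0_l, Rinv_1 in H. auto. }
  assert (HB : forall n k x, (k <= 3)%nat -> Rabs (w n k x) <= C).
  { intros n k x Hk; apply (app_bound _ _ _ _ _ _ _ _ _ (Happ n)); auto. }
  set (C' := (K + c2 + a) * C + 1 + C).
  assert (HC' : 0 <= C') by (unfold C'; nra).
  assert (Hlip : forall n k, (k <= 3)%nat -> forall x y, Rabs (w n k y - w n k x) <= C' * Rabs (y - x)).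
  { intros n k Hk x y. destruct (Nat.eq_dec k 3) as [->|Ne].
    - destruct (approx_deriv3_bound _ _ _ (Happ n) (Hle1 n)) as (f & Df & Bf).
      apply (lipschitz_of_derive _ f); auto. intros z; eapply Rle_trans; [apply Bf|unfold C'; lra].
    - apply (lipschitz_of_derive _ (w n (S k))).
      + intros z. apply (app_derive _ _ _ _ _ _ _ _ _ (Happ n)); lia.
      + intros z. eapply Rle_trans; [apply HB; lia|]. unfold C'. nra. }
  assert (DW : forall k x, (k < 3)%nat -> is_derive (W k) x (W (S k) x)).
  { intros k x Hk. apply (derive_of_limit (fun n => w n k) (fun n => w n (S k)) (W k) (W (S k)) rho rho C' 0); auto.
    - intros n y. apply (app_derive _ _ _ _ _ _ _ _ _ (Happ n)); auto.
    - intros n y z. rewrite Rmult_0_l, Rplus_0_r. apply Hlip; lia.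
    - intros n y; apply HW; lia. }
  assert (CW0 : cont (W 0%nat)) by (apply (cont_derive _ (W 1%nat)); intros; apply DW; lia).
  exists W, (l 4%nat); split; [auto|split; [|split; [|split; [|split]]]].
  - set (gn := fun n x => proj1_sig (constructive_indefinite_description _ (app_eq _ _ _ _ _ _ _ _ _ (Happ n))) x).
    set (rhs := fun n x => K * Rmax (w n 0%nat x - mu n) 0 + gn n x - c2 * w n 2%nat x - a * w n 0%nat x).
    assert (Hgn : forall n, (forall x, Rabs (gn n x) <= / (INR n + 1)) /\ forall x, is_derive (w n 3%nat) x (rhs n x)).
    { intros n. unfold rhs, gn.
      destruct (constructive_indefinite_description _ (app_eq _ _ _ _ _ _ _ _ _ (Happ n))) as [e He]; simpl; auto. }
    clearbody gn.
    apply (derive_of_limit (fun n => w n 3%nat) rhs (W 3%nat) _ rho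
       (fun x => (K + c2 + a) * rho x + K + 1) ((K + c2 + a) * C') 2).
    + nra.
    + intros n; apply Hgn.
    + intros n x y. destruct (Hgn n) as [Hg _].
      pose proof (Hg x) as g1. pose proof (Hg y) as g2.
      pose proof (Hlip n 0%nat ltac:(lia) x y) as l0. pose proof (Hlip n 2%nat ltac:(lia) x y) as l2.
      pose proof (Rmax_pos_lip (w n 0%nat y - mu n) (w n 0%nat x - mu n)) as P.
      replace (w n 0%nat y - mu n - (w n 0%nat x - mu n)) with (w n 0%nat y - w n 0%nat x) in P by ring.
      unfold rhs. set (B := C' * Rabs (y - x)) in *.
      replace ((K + c2 + a) * C' * Rabs (y - x)) with ((K + c2 + a) * B) by (unfold B; ring).
      assert (P' := Rle_trans _ _ _ P l0). clear P.
      apply Rabs_le_between in g1, g2, l0, l2, P'.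
      apply Rabs_le. nra.
    + intros n x; apply HW; lia.
    + intros n x. destruct (Hgn n) as [Hg _].
      pose proof (Hg x) as g1. pose proof (HW 0%nat x n ltac:(lia)) as l0. pose proof (HW 2%nat x n ltac:(lia)) as l2.
      pose proof (Rmax_pos_lip (w n 0%nat x - mu n) (W 0%nat x - l 4%nat)) as P.
      replace (w n 0%nat x - mu n - (W 0%nat x - l 4%nat)) with ((w n 0%nat x - W 0%nat x) + - (mu n - l 4%nat)) in P by ring.
      assert (P' := Rle_trans _ _ _ P (Rabs_triang _ _)). clear P. rewrite Rabs_Ropp in P'.
      pose proof (Hmu n) as M.
      assert (P'' : Rabs (Rmax (w n 0%nat x - mu n) 0 - Rmax (W 0%nat x - l 4%nat) 0) <= rho x * / (INR n + 1) + / (INR n + 1)) by lra.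
      clear P'. unfold rhs. set (dn := / (INR n + 1)) in *. set (B := rho x * dn) in *.
      replace (((K + c2 + a) * rho x + K + 1) * dn) with ((K + c2 + a) * B + K * dn + dn) by (unfold B; ring).
      apply Rabs_le_between in g1, l0, l2, P''.
      apply Rabs_le. nra.
  - intros k x Hk. apply (le_of_inv_succ _ _ (rho x)). intros n.
    specialize (HB n k x Hk). specialize (HW k x n Hk).
    replace (W k x) with (w n k x + - (w n k x - W k x)) by ring.
    eapply Rle_trans; [apply Rabs_triang|]. rewrite Rabs_Ropp. lra.
  - apply (le_of_inv_succ _ _ (rho 0)). intros n.
    pose proof (app_origin _ _ _ _ _ _ _ _ _ (Happ n)). specialize (HW 0%nat 0 n ltac:(lia)).
    apply Rabs_le_between in HW. lra.
  - apply (le_of_inv_succ _ _ 1). intros n.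
    pose proof (app_mu _ _ _ _ _ _ _ _ _ (Happ n)). specialize (Hmu n).
    apply Rabs_le_between in Hmu. lra.
  - intros x y Hxy. set (B := rho (Rmax (Rabs x) (Rabs y))).
    apply (le_of_inv_succ _ _ (2 * (C + B) * B * (y - x))). intros n.
    assert (Cwn : cont (w n 0%nat)).
    { apply (cont_derive _ (w n 1%nat)). intros z. apply (app_derive _ _ _ _ _ _ _ _ _ (Happ n)); lia. }
    pose proof (app_square _ _ _ _ _ _ _ _ _ (Happ n) x y Hxy) as Sq.
    assert (I : RInt (fun s => W 0%nat s ^ 2) x y <=
       RInt (fun s => 1 * w n 0%nat s ^ 2 + 1 * (2 * (C + B) * (B * / (INR n + 1)))) x y).
    { apply RInt_mono; [prove_cont|prove_cont|auto|]. intros z Hz.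
      assert (R1 : rho z <= B).
      { unfold B, rho. apply Rmult_le_compat_l; [lra|].
        assert (L * Rabs z <= L * Rabs (Rmax (Rabs x) (Rabs y))) as [Hlt| ->].
        { apply Rmult_le_compat_l; [lra|]. rewrite (Rabs_pos_eq (Rmax _ _)) by (eapply Rle_trans; [apply Rabs_pos|apply Rmax_l]).
          unfold Rmax; destruct (Rle_dec (Rabs x) (Rabs y)); unfold Rabs in *; repeat destruct Rcase_abs; lra. }
        - left; apply exp_increasing; auto.
        - lra. }
      pose proof (HW 0%nat z n ltac:(lia)) as H1. pose proof (HB n 0%nat z ltac:(lia)) as H2.
      pose proof (inv_succ_pos n) as Hn. pose proof (Hle1 n) as Hn1. pose proof (Hrho z).
      set (dn := / (INR n + 1)) in *.
      assert (H3 : rho z * dn <= B * dn) by (apply Rmult_le_compat_r; lra).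
      assert (H4 : B * dn <= B) by nra.
      apply Rabs_le_between in H1, H2. nra. }
    rewrite RInt_lin, RInt_cst in I by prove_cont. lra.
Qed.
End Limit.

(** * From a profile to a travelling wave *)

(** The tails of a bounded monotone primitive of [f^2] are small, and a Lipschitz function with
    small tails of its square integral is small. *)
Lemma square_integrable_decay (f g : R -> R) C :
  (forall x, is_derive f x (g x)) -> (forall x, Rabs (g x) <= C) ->
  (forall x y, x <= y -> RInt (fun s => f s ^ 2) x y <= C) -> is_lim f p_infty 0.
Proof.
  intros D Hg Hs.
  assert (Cf : cont f) by (apply (cont_derive _ _ D)).
  assert (Cf2 : cont (fun s => f s ^ 2)) by prove_cont.
  assert (HC : 0 <= C) by (eapply Rle_trans; [apply Rabs_pos|apply (Hg 0)]).
  set (J := fun x => RInt (fun s => f s ^ 2) 0 x).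
  set (S := fun z => exists x, 0 <= x /\ z = J x).
  destruct (completeness S) as [l [Hub Hlub]].
  { exists C. intros z (x & Hx & ->). apply Hs; auto. }
  { exists (J 0), 0; split; [lra|auto]. }
  apply lim_p_eps. intros eps He.
  set (K := C + 1).
  assert (HK : 0 < K) by (unfold K; lra).
  set (mass := eps ^ 3 / (8 * K)).
  assert (Hm : 0 < mass) by (apply Rdiv_lt_0_compat; [apply pow_lt; auto|lra]).
  assert (Hx0 : exists x0, 0 <= x0 /\ l - mass < J x0).
  { apply NNPP; intros N. assert (l <= l - mass); [|lra]. apply Hlub. intros z (x & Hx & ->).
    apply Rnot_lt_le; intros M; apply N; exists x; auto. }
  destruct Hx0 as (x0 & Hx0 & HJ). exists x0. intros x Hx. rewrite Rminus_0_r.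
  apply Rnot_lt_le; intros Hlt.
  assert (Hh : 0 < eps / (2 * K)) by (apply Rdiv_lt_0_compat; lra).
  assert (B : mass <= RInt (fun y => f y ^ 2) x (x + eps / (2 * K))).
  { apply (lipschitz_square_mass f K x eps); auto; [|lra].
    intros y z. eapply Rle_trans; [apply (lipschitz_of_derive f g C); auto|].
    apply Rmult_le_compat_r; [apply Rabs_pos|unfold K; lra]. }
  assert (U : J (x + eps / (2 * K)) <= l).
  { apply Hub. exists (x + eps / (2 * K)); split; [lra|auto]. }
  unfold J in U, HJ.
  rewrite (RInt_split _ 0 x0), (RInt_split _ x0 x) in U by auto.
  assert (0 <= RInt (fun s => f s ^ 2) x0 x).
  { apply RInt_nonneg; [auto|lra|]. intros y _; apply pow2_ge_0. }
  lra.
Qed.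

(** On an interval of length [h] the mean value theorem provides a point where [g] is a
    difference quotient of [f], hence small; the Lipschitz bound costs at most [C h]. *)
Lemma derivative_decay (f g : R -> R) C :
  (forall x, is_derive f x (g x)) -> (forall x y, Rabs (g y - g x) <= C * Rabs (y - x)) ->
  is_lim f p_infty 0 -> is_lim g p_infty 0.
Proof.
  intros D Hg Hf.
  assert (HC : 0 <= C).
  { specialize (Hg 0 1). rewrite Rminus_0_r, Rabs_R1 in Hg.
    pose proof (Rabs_pos (g 1 - g 0)). lra. }
  apply lim_p_eps. intros eps He.
  set (h := eps / (2 * (C + 1))).
  assert (Hh : 0 < h) by (apply Rdiv_lt_0_compat; lra).
  assert (HCh : C * h <= eps / 2).
  { assert ((C + 1) * h = eps / 2) by (unfold h; field; lra). nra. }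
  assert (Hd : 0 < eps * h / 4) by (assert (0 < eps * h) by nra; lra).
  apply is_lim_spec in Hf. destruct (Hf (mkposreal _ Hd)) as [M HM]; simpl in HM.
  exists M. intros x Hx. rewrite Rminus_0_r.
  pose proof (HM x Hx) as F1. pose proof (HM (x + h) ltac:(lra)) as F2.
  destruct (mean_value f g x (x + h) D) as [z [Hz E]].
  rewrite Rmin_left, Rmax_right in Hz by lra.
  pose proof (Hg x z) as G. rewrite (Rabs_pos_eq (z - x)) in G by lra.
  assert (C * (z - x) <= C * h) by (apply Rmult_le_compat_l; lra).
  replace (x + h - x) with h in E by ring.
  apply Rabs_lt_between in F1, F2. apply Rabs_le_between in G.
  assert (- (eps / 2) <= g z <= eps / 2) by (split; nra).
  apply Rabs_le; lra.
Qed.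

Lemma derive_chain (Y : nat -> R -> R) n :
  (forall k x, (k < n)%nat -> is_derive (Y k) x (Y (S k) x)) ->
  forall k x, (k <= n)%nat -> Derive_n (Y 0%nat) k x = Y k x /\ ex_derive_n (Y 0%nat) k x.
Proof.
  intros H k. induction k as [|k IH]; intros x Hk; simpl; [auto|].
  assert (E : forall y, Y k y = Derive_n (Y 0%nat) k y) by (intros y; symmetry; apply IH; lia).
  assert (D : is_derive (Derive_n (Y 0%nat) k) x (Y (S k) x)).
  { apply (is_derive_ext (Y k)); auto. }
  split; [apply is_derive_unique; auto|exists (Y (S k) x); auto].
Qed.

Lemma continuity_2d_travelling (f : R -> R) c x t : cont f ->
  continuity_2d_pt (fun x t => f (x - c * t)) x t.
Proof.
  intros Hf. apply (continuity_1d_2d_pt_comp f (fun x t => x - c * t)).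
  - apply continuity_pt_filterlim. apply Hf.
  - apply continuity_2d_pt_minus; [apply continuity_2d_pt_id1|].
    apply continuity_2d_pt_mult; [apply continuity_2d_pt_const|apply continuity_2d_pt_id2].
Qed.

Lemma regular_travelling (Y : nat -> R -> R) c :
  (forall k x, (k < 4)%nat -> is_derive (Y k) x (Y (S k) x)) -> cont (Y 4%nat) ->
  let u := fun x t => Y 0%nat (x - c * t) in
  regular u /\
  (forall k x t, (k <= 4)%nat -> partial_x k u x t = Y k (x - c * t)) /\
  (forall k x t, (k <= 4)%nat -> partial_t k u x t = (- c) ^ k * Y k (x - c * t)).
Proof.
  intros D C4 u.
  assert (CY : forall k, (k <= 4)%nat -> cont (Y k)).
  { intros k Hk. destruct (Nat.eq_dec k 4) as [->|N]; auto.
    apply (cont_derive _ (Y (S k))). intros; apply D; lia. }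
  assert (X : forall k x t, (k <= 4)%nat ->
    Derive_n (fun x' => u x' t) k x = Y k (x - c * t) /\ ex_derive_n (fun x' => u x' t) k x).
  { intros k x t Hk. apply (derive_chain (fun k x => Y k (x - c * t)) 4); auto.
    intros j y Hj. eapply D_eq; [apply (D_comp (Y j)); [apply D; auto|apply D_minus; [apply D_id|apply D_const]]|ring]. }
  assert (T : forall k x t, (k <= 4)%nat ->
    Derive_n (fun t' => u x t') k t = (- c) ^ k * Y k (x - c * t) /\ ex_derive_n (fun t' => u x t') k t).
  { intros k x t Hk.
    pose proof (derive_chain (fun k t => (- c) ^ k * Y k (x - c * t)) 4) as Ch.
    assert (E : forall t', u x t' = (- c) ^ 0 * Y 0%nat (x - c * t')) by (intros; unfold u; simpl; ring).
    destruct (Ch) with (k := k) (x := t) as [C1 C2]; auto.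
    - intros j y Hj. eapply D_eq.
      + apply D_mult; [apply D_const|]. apply (D_comp (Y j)); [apply D; auto|].
        apply D_minus; [apply D_const|apply D_mult; [apply D_const|apply D_id]].
      + simpl. ring.
    - split.
      + etransitivity; [apply (Derive_n_ext _ _ k t E)|exact C1].
      + apply (ex_derive_n_ext (fun t' => (- c) ^ 0 * Y 0%nat (x - c * t'))); auto. }
  split; [|split; intros k x t Hk; [exact (proj1 (X k x t Hk))|exact (proj1 (T k x t Hk))]].
  intros x t _. split; intros k Hk; split.
  - exact (proj2 (X k x t Hk)).
  - apply (continuity_2d_pt_ext (fun x t => Y k (x - c * t))).
    + intros y s. symmetry; exact (proj1 (X k y s Hk)).
    + apply continuity_2d_travelling; auto.
  - exact (proj2 (T k x t ltac:(lia))).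
  - apply (continuity_2d_pt_ext (fun x t => (- c) ^ k * Y k (x - c * t))).
    + intros y s. symmetry; exact (proj1 (T k y s ltac:(lia))).
    + apply continuity_2d_pt_mult; [apply continuity_2d_pt_const|].
      apply continuity_2d_travelling; apply CY; lia.
Qed.

(** The wave is [y = (mu - W) / (a mu)]: it is nonnegative exactly where [W <= mu], and there
    the truncation vanishes, which matches the two branches of the nonlinearity. *)
Lemma wave_of_profile a b c C (W : nat -> R -> R) mu : 0 < b -> b < a -> 0 < mu ->
  (forall k x, (k < 3)%nat -> is_derive (W k) x (W (S k) x)) ->
  (forall x, is_derive (W 3%nat) x
     ((a - b) * Rmax (W 0%nat x - mu) 0 - c ^ 2 * W 2%nat x - a * W 0%nat x)) ->
  (forall k x, (k <= 3)%nat -> Rabs (W k x) <= C) ->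
  0 < W 0%nat 0 ->
  (forall x y, x <= y -> RInt (fun s => W 0%nat s ^ 2) x y <= C) ->
  exists u, travelling_wave_solution a b c u.
Proof.
  intros Hb Hab Hmu D D3 B W0 Sq.
  set (W4 := fun x => (a - b) * Rmax (W 0%nat x - mu) 0 - c ^ 2 * W 2%nat x - a * W 0%nat x).
  set (Y := fun k x => match k with
     | 0%nat => / (a * mu) * (mu - W 0%nat x)
     | 1%nat => - / (a * mu) * W 1%nat x
     | 2%nat => - / (a * mu) * W 2%nat x
     | 3%nat => - / (a * mu) * W 3%nat x
     | _ => - / (a * mu) * W4 x end).
  assert (Ham : 0 < a * mu) by nra.
  assert (D0 : forall x, is_derive (W 0%nat) x (W 1%nat x)) by auto.
  assert (D1 : forall x, is_derive (W 1%nat) x (W 2%nat x)) by auto.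
  assert (D2 : forall x, is_derive (W 2%nat) x (W 3%nat x)) by auto.
  assert (DY : forall k x, (k < 4)%nat -> is_derive (Y k) x (Y (S k) x)).
  { intros k x Hk. assert (k = 0 \/ k = 1 \/ k = 2 \/ k = 3)%nat as [-> | [-> | [-> | ->]]] by lia;
      unfold Y, W4; prove_derive; ring. }
  assert (C4 : cont (Y 4%nat)).
  { unfold Y, W4. assert (cont (W 0%nat)) by prove_cont. assert (cont (W 2%nat)) by prove_cont. prove_cont. }
  destruct (regular_travelling Y c DY C4) as (Reg & PX & PT).
  assert (LW : is_lim (W 0%nat) p_infty 0 /\ is_lim (W 0%nat) m_infty 0).
  { split.
    - apply (square_integrable_decay _ (W 1%nat) C); auto.
    - apply lim_of_reflection.
      apply (square_integrable_decay _ (fun x => - W 1%nat (- x)) C).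
      + intros x. eapply D_eq; [apply (D_comp (W 0%nat)); [apply D0|apply D_opp, D_id]|ring].
      + intros x; rewrite Rabs_Ropp; auto.
      + intros x y Hxy.
        assert (C0 : cont (fun s => W 0%nat s ^ 2)) by (assert (cont (W 0%nat)) by prove_cont; prove_cont).
        rewrite (RInt_FTC (fun x => - RInt (fun s => W 0%nat s ^ 2) (- y) (- x))).
        * assert (Z : RInt (fun s => W 0%nat s ^ 2) (- y) (- y) = 0).
          { apply RInt_zero_on. intros s Hs. rewrite Rmin_left, Rmax_left in Hs; lra. }
          rewrite Z, Ropp_0. unfold Rminus. rewrite Rplus_0_l, Ropp_involutive. apply Sq; lra.
        * assert (cont (W 0%nat)) by prove_cont. prove_cont.
        * intros s. pose proof (derive_RInt_cont _ (- y) C0) as DI.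
          eapply D_eq; [apply D_opp; apply (D_comp (fun z => RInt (fun s => W 0%nat s ^ 2) (- y) z)); [apply DI|apply D_opp, D_id]|].
          simpl; ring. }
  destruct LW as [Lp Lm].
  assert (Lip1 : forall x y, Rabs (W 1%nat y - W 1%nat x) <= C * Rabs (y - x)).
  { apply (lipschitz_of_derive _ (W 2%nat)); auto. }
  assert (L1p : is_lim (W 1%nat) p_infty 0) by (apply (derivative_decay (W 0%nat) _ C); auto).
  assert (L1m : is_lim (W 1%nat) m_infty 0).
  { apply lim_of_reflection.
    assert (L : is_lim (fun x => - W 1%nat (- x)) p_infty 0).
    { apply (derivative_decay (fun x => W 0%nat (- x)) _ C).
      - intros x. eapply D_eq; [apply (D_comp (W 0%nat)); [apply D0|apply D_opp, D_id]|ring].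
      - intros x y. replace (- W 1%nat (- y) - - W 1%nat (- x)) with (- (W 1%nat (- y) - W 1%nat (- x))) by ring.
        rewrite Rabs_Ropp. eapply Rle_trans; [apply Lip1|].
        replace (- y - - x) with (- (y - x)) by ring. rewrite Rabs_Ropp; lra.
      - apply lim_reflect_m; auto. }
    apply (lim_scal0 _ (-1)) in L. eapply is_lim_ext; [|exact L]. intros x; simpl; ring. }
  assert (LY0 : forall z, is_lim (W 0%nat) z 0 -> is_lim (Y 0%nat) z (1 / a)).
  { intros z Hz. apply (is_lim_ext (fun x => 1 / a + (- / (a * mu)) * W 0%nat x)).
    - intros x; unfold Y; field; lra.
    - replace (Finite (1 / a)) with (Finite (1 / a + 0)) by (f_equal; ring).
      apply (is_lim_plus' _ _ _ (1 / a) 0); [apply is_lim_const|apply lim_scal0; auto]. }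
  exists (fun x t => Y 0%nat (x - c * t)). split; [split; [exact Reg|split]|].
  - intros x t Ht. rewrite (PX 4%nat), (PT 2%nat) by lia.
    set (s := x - c * t). unfold pos_part, neg_part.
    assert (HP : 0 < / (a * mu)) by (apply Rinv_0_lt_compat; auto).
    assert (E1 : / (a * mu) * mu * a = 1) by (field; lra).
    unfold Y, W4.
    set (P := / (a * mu)) in *. set (w0 := W 0%nat s). set (w2 := W 2%nat s).
    destruct (Rle_lt_dec w0 mu) as [Hw|Hw].
    + rewrite (Rmax_left (P * (mu - w0))), (Rmax_right (- _)), (Rmax_right (w0 - mu)) by nra. lra.
    + rewrite (Rmax_right (P * (mu - w0))), (Rmax_left (- _)), (Rmax_left (w0 - mu)) by nra. lra.
  - intros t Ht.
    split; [apply lim_shift; auto|split; [apply lim_shift; auto|]].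
    split.
    + apply (is_lim_ext (fun x => Y 1%nat (x - c * t))); [intros; symmetry; apply PX; lia|].
      apply lim_shift. unfold Y. apply lim_scal0; auto.
    + apply (is_lim_ext (fun x => Y 1%nat (x - c * t))); [intros; symmetry; apply PX; lia|].
      apply lim_shift. unfold Y. apply lim_scal0; auto.
  - exists (Y 0%nat); split; [auto|]. exists 0. unfold Y.
    assert (HP : 0 < / (a * mu)) by (apply Rinv_0_lt_compat; auto).
    assert (E1 : / (a * mu) * mu = 1 / a) by (field; lra).
    assert (0 < / (a * mu) * W 0%nat 0) by (apply Rmult_lt_0_compat; auto).
    lra.
Qed.

(** * A trial function made of parabolic humps *)

Section Trial.
Variables c2 a K : R.

Definition quad_form (beta : R) (phi phi2 : R -> R) (x : R) : R :=
  phi2 x ^ 2 + c2 * (phi x * phi2 x) + beta * phi x ^ 2.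

(** The form of [w - phi] is nonnegative.  Its mixed part equals [2 phi L w] up to the
    derivative of the boundary term [bd], and [L w = v].  The hypothesis on [v] covers both
    cases that occur: [v = K phi] with [beta = a - K] where [phi >= 0], and [v = 0] with
    [beta = a].  Working piecewise allows [phi] to have jumps in its second derivative, as
    [bd] only involves [phi] and its derivative. *)
Lemma trial_piece v w p l beta (phi phi1 phi2 : R -> R) :
  cont v -> resolvent c2 a v w -> c2 ^ 2 < 4 * a ->
  (forall x, is_derive phi x (phi1 x)) -> (forall x, is_derive phi1 x (phi2 x)) -> cont phi2 ->
  0 <= l ->
  (forall x, 0 <= x <= l -> 2 * v (p + x) * phi x - v (p + x) * v (p + x) / K = (a - beta) * phi x ^ 2) ->
  let G := fun x => RInt (fun s => quad_form a (w 0%nat) (w 2%nat) s - v s * v s / K) 0 x in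
  let bd := fun x s => 2 * (w 2%nat s * phi1 x - w 3%nat s * phi x)
                       + c2 * (w 0%nat s * phi1 x - w 1%nat s * phi x) in
  G p - bd 0 p <= G (p + l) - bd l (p + l) + RInt (quad_form beta phi phi2) 0 l.
Proof.
  intros Cv Rw Hca Dp Dp1 Cp2 Hl Hv G bd.
  assert (C0 : cont (w 0%nat)) by (apply (res_cont c2 a v w 0); auto).
  assert (C2 : cont (w 2%nat)) by (apply (res_cont c2 a v w 2); auto).
  assert (Cp : cont phi) by prove_cont.
  destruct Rw as [D D3 _ _].
  assert (D0 : forall x, is_derive (w 0%nat) x (w 1%nat x)) by auto.
  assert (D1 : forall x, is_derive (w 1%nat) x (w 2%nat x)) by auto.
  assert (D2 : forall x, is_derive (w 2%nat) x (w 3%nat x)) by auto.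
  assert (DG : forall x, is_derive G x (quad_form a (w 0%nat) (w 2%nat) x - v x * v x / K)).
  { apply derive_RInt_cont. unfold quad_form, Rdiv. prove_cont. }
  assert (Cq : cont (quad_form beta phi phi2)) by (unfold quad_form; prove_cont).
  pose proof (derive_RInt_cont _ 0 Cq) as DQ.
  set (Q := fun x => RInt (quad_form beta phi phi2) 0 x) in *.
  assert (I : G (p + 0) - bd 0 (p + 0) + Q 0 <= G (p + l) - bd l (p + l) + Q l).
  { apply (nondecreasing_of_derive (fun x => G (p + x) - bd x (p + x) + Q x)
      (fun x => (w 2%nat (p + x) - phi2 x) ^ 2 + c2 * ((w 0%nat (p + x) - phi x) * (w 2%nat (p + x) - phi2 x))
        + a * (w 0%nat (p + x) - phi x) ^ 2)); auto.
    - intros x Hx. specialize (Hv x Hx). unfold bd. prove_derive. unfold quad_form. unfold Rdiv in *. lra.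
    - intros x _.
      pose proof (energy_lower c2 a (w 0%nat (p + x) - phi x) (w 2%nat (p + x) - phi2 x)).
      pose proof (pow2_ge_0 (w 0%nat (p + x) - phi x)). nra. }
  assert (Z : Q 0 = 0).
  { unfold Q. apply RInt_zero_on. intros s Hs. rewrite Rmin_left, Rmax_left in Hs; lra. }
  rewrite Rplus_0_r, Z, Rplus_0_r in I. exact I.
Qed.

(** [int (phi''^2 + c2 phi phi'' + beta phi^2)] over the parabola [phi x = x (l - x) / l] on
    [0, l], normalised to have slopes 1 and -1 at its ends. *)
Definition hump_cost (beta l : R) : R := 4 / l - c2 * l / 3 + beta * l ^ 3 / 30.

Lemma trial_hump v w p l sg beta :
  cont v -> resolvent c2 a v w -> c2 ^ 2 < 4 * a -> 0 < l -> sg * sg = 1 ->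
  (forall x, 0 <= x <= l -> 2 * v (p + x) * (sg * (x * (l - x) / l)) - v (p + x) * v (p + x) / K
     = (a - beta) * (x * (l - x) / l) ^ 2) ->
  let G := fun x => RInt (fun s => quad_form a (w 0%nat) (w 2%nat) s - v s * v s / K) 0 x in
  let Z := fun s => 2 * w 2%nat s + c2 * w 0%nat s in
  G p - sg * Z p <= G (p + l) + sg * Z (p + l) + hump_cost beta l.
Proof.
  intros Cv Rw Hca Hl Hsg Hv G Z.
  pose proof (trial_piece v w p l beta (fun x => sg * (x * (l - x) / l))
     (fun x => sg * (1 - 2 * x / l)) (fun x => sg * (- 2 / l)) Cv Rw Hca) as T.
  assert (E : hump_cost beta l = RInt (quad_form beta (fun x => sg * (x * (l - x) / l)) (fun x => sg * (- 2 / l))) 0 l).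
  { rewrite (RInt_FTC (fun x => 4 / l ^ 2 * x + c2 * (- 2 / l) * (x ^ 2 / 2 - x ^ 3 / (3 * l))
       + beta * (x ^ 3 / 3 - x ^ 4 / (2 * l) + x ^ 5 / (5 * l ^ 2)))).
    - unfold hump_cost. field; lra.
    - unfold quad_form, Rdiv; prove_cont.
    - intros x. unfold Rdiv. prove_derive. unfold quad_form.
      transitivity ((sg * sg) * (4 / l ^ 2) + c2 * ((sg * sg) * ((x * (l - x) / l) * (- 2 / l)))
         + beta * ((sg * sg) * (x * (l - x) / l) ^ 2)).
      + rewrite Hsg. field; lra.
      + field; lra. }
  cbv zeta in T. rewrite <- E in T. cbv beta in T. unfold G, Z.
  assert (T' := T ltac:(intros x; unfold Rdiv; prove_derive; field; lra) ltac:(intros x; unfold Rdiv; prove_derive; field; lra)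
     ltac:(unfold Rdiv; prove_cont) ltac:(lra)). clear T.
  replace (sg * (0 * (l - 0) / l)) with 0 in T' by (field; lra).
  replace (sg * (l * (l - l) / l)) with 0 in T' by (field; lra).
  replace (sg * (1 - 2 * 0 / l)) with sg in T' by (field; lra).
  replace (sg * (1 - 2 * l / l)) with (- sg) in T' by (field; lra).
  assert (T := T' ltac:(intros x Hx; rewrite (Hv x Hx); rewrite <- (Rmult_1_l ((x * (l - x) / l) ^ 2)), <- Hsg at 1; ring)).
  lra.
Qed.
End Trial.

Fixpoint hump_train (K l T : R) (n : nat) (x : R) : R :=
  match n with
  | O => 0
  | S n => hump_train K l T n x + K * Rmax ((x - INR n * T) * (l - (x - INR n * T)) / l) 0
  end.

Lemma hump_outside l x : 0 < l -> x <= 0 \/ l <= x -> Rmax (x * (l - x) / l) 0 = 0.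
Proof.
  intros Hl Hx. apply Rmax_right.
  assert (0 < / l) by (apply Rinv_0_lt_compat; auto).
  assert (x * (l - x) <= 0) by (destruct Hx; nra).
  unfold Rdiv; nra.
Qed.

Lemma hump_inside l x : 0 < l -> 0 <= x <= l -> Rmax (x * (l - x) / l) 0 = x * (l - x) / l.
Proof.
  intros Hl Hx. apply Rmax_left. apply Rdiv_le_0_compat; nra.
Qed.

Section Train.
Variables K l T : R.
Hypothesis HK : 0 < K.
Hypothesis Hl : 0 < l.
Hypothesis HT : l < T.

Lemma train_outside n x : x <= 0 \/ INR n * T <= x -> hump_train K l T n x = 0.
Proof.
  induction n as [|n IH]; intros Hx; [reflexivity|].
  simpl hump_train. rewrite S_INR in Hx. pose proof (pos_INR n).
  rewrite IH, hump_outside; [ring|auto| |]; destruct Hx; nra.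
Qed.

Lemma train_on_period n i x : (i < n)%nat -> INR i * T <= x <= (INR i + 1) * T ->
  hump_train K l T n x = K * Rmax ((x - INR i * T) * (l - (x - INR i * T)) / l) 0.
Proof.
  induction n as [|n IH]; intros Hi Hx; [lia|].
  simpl hump_train. destruct (Nat.eq_dec i n) as [->|N].
  - rewrite train_outside by (right; lra). ring.
  - rewrite IH by (auto; lia).
    assert (INR i + 1 <= INR n) by (rewrite <- S_INR; apply le_INR; lia).
    rewrite (hump_outside l (x - INR n * T)); [ring|auto|left; nra].
Qed.

Lemma train_bump n : bump (hump_train K l T n).
Proof.
  split; [|split].
  - induction n as [|n IH]; simpl; [prove_cont|]. unfold Rdiv. prove_cont.
  - intros x. induction n as [|n IH]; simpl; [lra|].
    pose proof (Rmax_r ((x - INR n * T) * (l - (x - INR n * T)) / l) 0). nra.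
  - exists (INR n * T). pose proof (pos_INR n). split; [nra|].
    intros x Hx. apply train_outside. unfold Rabs in Hx. destruct (Rcase_abs x); [left|right]; nra.
Qed.
End Train.

(** The trial function starts with the cubic [x^3 - x^2] on a unit interval, which joins the
    zero function to slope 1, continues with [n] periods made of a positive and a negative
    parabola, and ends with the cubic [x - 2 x^2 + x^3].  Only the positive parabolas enter
    [v]; dropping the positive end piece from [v] costs a bounded amount.  The boundary
    terms of neighbouring pieces cancel in the sum. *)
Lemma positive_rayleigh c2 a b l1 l2 C0 : 0 < b -> b < a -> 0 < l1 -> 0 < l2 -> c2 ^ 2 < 4 * a ->
  (forall v t, bump v -> total v t -> exists w, resolvent c2 a v w /\
    forall k x, (k <= 3)%nat -> Rabs (w k x) <= C0 * t) ->
  hump_cost c2 b l2 + hump_cost c2 a l1 < 0 ->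
  exists v w t q p, bump v /\ resolvent c2 a v w /\ total v t /\
    (forall k x, (k <= 3)%nat -> Rabs (w k x) <= C0 * t) /\
    total (fun x => v x * v x) q /\ total (fun x => v x * w 0%nat x) p /\
    0 < p - q / (a - b).
Proof.
  intros Hb Hab H1 H2 Hca HR Hper.
  set (K := a - b). assert (HK : 0 < K) by (unfold K; lra).
  set (per := hump_cost c2 b l2 + hump_cost c2 a l1) in *.
  set (h1 := RInt (quad_form c2 a (fun x => x ^ 3 - x ^ 2) (fun x => 6 * x - 2)) 0 1).
  set (h2 := RInt (quad_form c2 a (fun x => x - 2 * x ^ 2 + x ^ 3) (fun x => 6 * x - 4)) 0 1).
  (* [h1] and [h2] are the costs of the two ends; [n] periods must outweigh them. *)
  destruct (INR_unbounded ((h1 + h2) / - per)) as [n Hn].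
  assert (Hneg : INR n * per + h1 + h2 < 0).
  { assert ((h1 + h2) / - per * - per = h1 + h2) by (field; lra). nra. }
  set (T := l1 + l2). set (v := hump_train K l2 T n).
  assert (HT : l2 < T) by (unfold T; lra).
  assert (Hv : bump v) by (apply train_bump; auto).
  pose proof (proj1 Hv) as Cv.
  destruct (bump_total v Hv) as [t Tt].
  destruct (HR v t Hv Tt) as (w & Rw & Bw).
  assert (C0w : cont (w 0%nat)) by (apply (res_cont c2 a v w 0); auto).
  assert (C2w : cont (w 2%nat)) by (apply (res_cont c2 a v w 2); auto).
  destruct (bump_total_mult v v Hv Cv) as [q Tq].
  destruct (bump_total_mult v (w 0%nat) Hv C0w) as [p Tp].
  exists v, w, t, q, p. repeat (split; [auto|]).
  set (g := fun s => quad_form c2 a (w 0%nat) (w 2%nat) s - v s * v s / K).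
  assert (Cg : cont g) by (unfold g, quad_form, Rdiv; prove_cont).
  assert (Tg : total g (p - q / K)).
  { apply (total_ext _ _ _ _ (total_lin _ _ _ _ 1 (- / K) (green_energy c2 a v w p Cv Rw Tp) Tq)).
    - intros x. unfold g, quad_form, Rdiv; ring.
    - unfold Rdiv; ring. }
  set (G := fun x => RInt g 0 x).
  set (Z := fun s => 2 * w 2%nat s + c2 * w 0%nat s).
  assert (Period : forall i, (i < n)%nat ->
     G (INR i * T) - Z (INR i * T) <= G (INR (S i) * T) - Z (INR (S i) * T) + per).
  { intros i Hi. rewrite S_INR.
    pose proof (trial_hump c2 a K v w (INR i * T) l2 1 b Cv Rw Hca H2 ltac:(ring)) as P1.
    cbv zeta in P1.
    assert (V1 : forall x, 0 <= x <= l2 -> v (INR i * T + x) = K * (x * (l2 - x) / l2)).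
    { intros x Hx. unfold v. rewrite (train_on_period K l2 T H2 HT n i) by (auto; lra).
      replace (INR i * T + x - INR i * T) with x by ring. rewrite hump_inside; auto. }
    assert (V2 : forall x, 0 <= x <= l1 -> v (INR i * T + l2 + x) = 0).
    { intros x Hx. unfold v. rewrite (train_on_period K l2 T H2 HT n i) by (auto; unfold T; lra).
      replace (INR i * T + l2 + x - INR i * T) with (l2 + x) by ring.
      rewrite hump_outside; [ring|auto|right; lra]. }
    assert (P1' := P1 ltac:(intros x Hx; rewrite (V1 x Hx); unfold K; field; unfold K in HK; lra)).
    pose proof (trial_hump c2 a K v w (INR i * T + l2) l1 (-1) a Cv Rw Hca H1 ltac:(ring)) as P2.
    cbv zeta in P2.
    assert (P2' := P2 ltac:(intros x Hx; rewrite (V2 x Hx); field; lra)).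
    replace (INR i * T + l2 + l1) with ((INR i + 1) * T) in P2' by (unfold T; ring).
    change (G (INR i * T) - 1 * Z (INR i * T)
      <= G (INR i * T + l2) + 1 * Z (INR i * T + l2) + hump_cost c2 b l2) in P1'.
    change (G (INR i * T + l2) - -1 * Z (INR i * T + l2)
      <= G ((INR i + 1) * T) + -1 * Z ((INR i + 1) * T) + hump_cost c2 a l1) in P2'.
    unfold per. lra. }
  assert (Chain : forall i, (i <= n)%nat -> G 0 - Z 0 <= G (INR i * T) - Z (INR i * T) + INR i * per).
  { induction i as [|i IH]; intros Hi.
    - simpl INR. rewrite !Rmult_0_l. lra.
    - specialize (IH ltac:(lia)). specialize (Period i ltac:(lia)). rewrite S_INR in *. lra. }
  assert (Head : G (-1) <= G 0 - Z 0 + h1).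
  { pose proof (trial_piece c2 a K v w (-1) 1 a (fun x => x ^ 3 - x ^ 2) (fun x => 3 * x ^ 2 - 2 * x)
      (fun x => 6 * x - 2) Cv Rw Hca ltac:(intros x; prove_derive; ring) ltac:(intros x; prove_derive; ring) ltac:(prove_cont) ltac:(lra)) as P.
    cbv zeta beta in P. fold h1 in P.
    assert (P' := P ltac:(intros x Hx; unfold v; rewrite train_outside by (auto; left; lra); field; lra)).
    replace (-1 + 1) with 0 in P' by ring. unfold G, Z, g. lra. }
  assert (Tail : G (INR n * T) - Z (INR n * T) <= G (INR n * T + 1) + h2).
  { pose proof (trial_piece c2 a K v w (INR n * T) 1 a (fun x => x - 2 * x ^ 2 + x ^ 3) (fun x => 1 - 4 * x + 3 * x ^ 2)
      (fun x => 6 * x - 4) Cv Rw Hca ltac:(intros x; prove_derive; ring) ltac:(intros x; prove_derive; ring) ltac:(prove_cont) ltac:(lra)) as P.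
    cbv zeta beta in P. fold h2 in P.
    assert (P' := P ltac:(intros x Hx; unfold v; rewrite train_outside by (auto; right; lra); field; lra)).
    unfold G, Z, g. lra. }
  specialize (Chain n (le_n n)).
  assert (HnT : 0 <= INR n * T) by (pose proof (pos_INR n); unfold T; nra).
  (* Outside the trial function [v] vanishes and [g] is nonnegative. *)
  assert (Whole : RInt g (-1) (INR n * T + 1) <= p - q / K).
  { apply total_part; auto; [|lra].
    intros x Hx. unfold g, quad_form. unfold v; rewrite train_outside by (first [assumption | destruct Hx; [left|right]; lra]).
    pose proof (energy_lower c2 a (w 0%nat x) (w 2%nat x)). pose proof (pow2_ge_0 (w 0%nat x)).
    unfold Rdiv. nra. }
  rewrite (RInt_split g (-1) 0) in Whole by auto.
  assert (Sw : RInt g (-1) 0 = - G (-1)).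
  { unfold G. rewrite <- (opp_RInt_swap g) by (apply cont_ex_RInt; auto). reflexivity. }
  rewrite Sw in Whole. fold (G (INR n * T + 1)) in Whole. lra.
Qed.

(** * Wave speeds *)

Lemma Rpower_root4 x : 0 < x -> root4 x ^ 4 = x.
Proof.
  intros Hx. unfold root4. rewrite <- Rpower_pow by apply exp_pos.
  rewrite Rpower_mult. replace (1 / 4 * INR 4) with 1 by (simpl; field). apply Rpower_1; auto.
Qed.

(** With lengths [l_i = s x_i] the sum of the costs has the form [(A - B s^2 + C s^4) / s].
    The choice [s^2 = 8 / c2] turns its negativity into
    [8 (a x1^3 + b x2^3) < c2^2 (10 (x1 + x2) - 15 (1 / x1 + 1 / x2))],
    which is the lower bound on [c2^2] with the definition of [calB] unfolded. *)
Lemma hump_costs_negative a b x1 x2 c2 : 0 < b -> b < a -> 0 < x1 -> 0 < x2 -> 0 < c2 ->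
  0 < calB x1 x2 (a / b) -> 4 * b / calB x1 x2 (a / b) < c2 ^ 2 ->
  exists l1 l2, 0 < l1 /\ 0 < l2 /\ hump_cost c2 b l2 + hump_cost c2 a l1 < 0.
Proof.
  intros Hb Hab H1 H2 Hc HB Hlow.
  set (N := 10 * (x1 + x2) - 15 * (1 / x1 + 1 / x2)).
  assert (Hx1 : 0 < x1 ^ 3) by (apply pow_lt; auto). assert (Hx2 : 0 < x2 ^ 3) by (apply pow_lt; auto).
  assert (HBN : calB x1 x2 (a / b) * (2 * (a * x1 ^ 3 + b * x2 ^ 3)) = b * N).
  { unfold calB, N. field. repeat split; nra. }
  assert (Hden : 0 < 2 * (a * x1 ^ 3 + b * x2 ^ 3)) by nra.
  assert (Key : 8 * (a * x1 ^ 3 + b * x2 ^ 3) < c2 ^ 2 * N).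
  { apply (Rmult_lt_compat_r (calB x1 x2 (a / b))) in Hlow; auto.
    replace (4 * b / calB x1 x2 (a / b) * calB x1 x2 (a / b)) with (4 * b) in Hlow by (field; lra).
    apply (Rmult_lt_compat_r (2 * (a * x1 ^ 3 + b * x2 ^ 3))) in Hlow; auto.
    replace (c2 ^ 2 * calB x1 x2 (a / b) * (2 * (a * x1 ^ 3 + b * x2 ^ 3)))
      with (c2 ^ 2 * (b * N)) in Hlow by (rewrite <- HBN; ring).
    apply Rmult_lt_reg_l with b; auto. lra. }
  assert (H8 : 0 < 8 / c2) by (apply Rdiv_lt_0_compat; lra).
  pose proof (sqrt_lt_R0 _ H8) as Hs. pose proof (sqrt_sqrt _ (Rlt_le _ _ H8)) as Hss.
  set (s := sqrt (8 / c2)) in *.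
  exists (x1 * s), (x2 * s). split; [nra|split; [nra|]].
  apply Rmult_lt_reg_l with (15 * s * c2 ^ 2); [apply Rmult_lt_0_compat; [lra|apply pow_lt; auto]|].
  rewrite Rmult_0_r.
  assert (E2 : s * s * c2 = 8) by (rewrite Hss; field; lra).
  apply Rle_lt_trans with (4 * (8 * (a * x1 ^ 3 + b * x2 ^ 3) - c2 ^ 2 * N)); [right|lra].
  unfold hump_cost, N.
  transitivity (60 * c2 ^ 2 * (1 / x1 + 1 / x2) - 5 * c2 ^ 2 * (s * s * c2) * (x1 + x2)
     + / 2 * ((s * s * c2) * (s * s * c2)) * (a * x1 ^ 3 + b * x2 ^ 3)).
  - field; repeat split; lra.
  - rewrite E2. field; lra.
Qed.

Theorem theorem12 (a b x1 x2 : R) (hb : 0 < b) (hab : b < a)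
    (hx1 : 0 < x1) (hx2 : 0 < x2)
    (hB : calB x1 x2 (a / b) > b / a)
    (c : R)
    (hc : root4 (4 * b / calB x1 x2 (a / b)) < Rabs c < root4 (4 * a)) :
  exists u : R -> R -> R, travelling_wave_solution a b c u.
Proof.
  assert (Hba : 0 < b / a) by (apply Rdiv_lt_0_compat; lra).
  assert (HB : 0 < calB x1 x2 (a / b)) by lra.
  assert (Hq : 0 < 4 * b / calB x1 x2 (a / b)) by (apply Rdiv_lt_0_compat; lra).
  destruct hc as [Hc1 Hc2].
  assert (Hr : 0 < root4 (4 * b / calB x1 x2 (a / b))) by apply exp_pos.
  assert (Pow : forall u z, 0 < u -> u < z -> u ^ 4 < z ^ 4).
  { intros u z Hu Hz. assert (u ^ 2 < z ^ 2) by nra. assert (0 < u ^ 2) by (apply pow_lt; auto).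
    replace (u ^ 4) with (u ^ 2 * u ^ 2) by ring. replace (z ^ 4) with (z ^ 2 * z ^ 2) by ring. nra. }
  pose proof (Pow _ _ Hr Hc1) as L1. pose proof (Pow (Rabs c) (root4 (4 * a)) ltac:(lra) Hc2) as L2.
  rewrite Rpower_root4 in L1, L2 by lra.
  replace (Rabs c ^ 4) with ((c ^ 2) ^ 2) in L1, L2 by (rewrite <- (pow2_abs c); ring).
  assert (Hcp : 0 < c ^ 2) by (rewrite <- (pow2_abs c); apply pow_lt; lra).
  destruct (resolvent_exists (c ^ 2) a ltac:(lra) ltac:(lra) L2) as (C0 & HC0 & HR).
  destruct (hump_costs_negative a b x1 x2 (c ^ 2)) as (l1 & l2 & Hl1 & Hl2 & Hcost); auto.
  destruct (positive_rayleigh (c ^ 2) a b l1 l2 C0) as (v & w & t & q & p & Hv & Rw & Tt & Bw & Tq & Tp & Hpos); auto.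
  pose proof (bump_total_nonneg v t Hv Tt) as Ht.
  set (eta := p - q / (a - b)) in *.
  (* Both penalties are made small compared with [eta]. *)
  set (mu0 := eta / (8 * (t + 1))). set (lam := eta / (8 * (t ^ 3 + 1))).
  assert (Ht3 : 0 <= t ^ 3) by (apply pow_le; auto).
  assert (Hmu0 : 0 < mu0) by (apply Rdiv_lt_0_compat; lra).
  assert (Hlam : 0 < lam) by (apply Rdiv_lt_0_compat; lra).
  assert (E1 : mu0 * (t + 1) = eta / 8) by (unfold mu0; field; lra).
  assert (E2 : lam * (t ^ 3 + 1) = eta / 8) by (unfold lam; field; lra).
  destruct (approx_solutions_exist (c ^ 2) a C0 (a - b) mu0 lam HC0 ltac:(lra) Hmu0 Hlam L2 HR
      v (p - q / (a - b) - 2 * mu0 * t - 2 / 3 * lam * t ^ 3)) as (C & m & HC & Hm & Happ).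
  { fold eta. nra. }
  { exists w, t, q, p. auto 10. }
  destruct (limit_solution (c ^ 2) a (a - b) C m mu0 ltac:(lra) ltac:(lra) ltac:(lra) ltac:(lra) ltac:(lra) Happ)
    as (W & mu & DW & DW3 & BW & W0 & Hmu & Sq).
  apply (wave_of_profile a b c C W mu); auto; lra.
Qed.
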